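(* Let $\Omega\subset\mathbb{C}$ be a bounded domain whose boundary consists of $n$ disjoint Jordan curves, let $V_0,\dots,V_{n-1}$ be the connected components of $\hat{\mathbb{C}}\setminus\Omega$ with $\infty\in V_0$, let $\Omega_i=\hat{\mathbb{C}}\setminus V_i$, and let $\phi_i:\overline{D}\to\overline{\Omega_i}$ be Riemann mappings ($i=0,\dots,n-1$). Then the class of functions $f\in A(\Omega)$ such that for every $i\in\{0,\dots,n-1\}$ the functions $\theta\mapsto\operatorname{Re}f(\phi_i(e^{i\theta}))$ and $\theta\mapsto\operatorname{Im}f(\phi_i(e^{i\theta}))$, $\theta\in\mathbb{R}$, are nowhere differentiable is residual in $A(\Omega)$.
   Context: $D$ is the open unit disc, $\mathbb{T}=\partial D$. A Riemann mapping $\phi_i:\overline{D}\to\overline{\Omega_i}$ (closure in $\hat{\mathbb{C}}$) is a homeomorphism mapping $D$ conformally onto $\Omega_i$; note $\phi_i(\mathbb{T})=\partial V_i\subset\partial\Omega$. $A(\Omega)$ is the space of functions continuous on $\overline{\Omega}$ and holomorphic on $\Omega$, with the supremum norm on $\overline{\Omega}$. *)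

(* Defs.v *)
(* The complex plane is R[i] (mathcomp-real-closed
   `complex`) over a real type R, equipped (below) with its canonical
   normed-module structure over itself (R[i]^o), so that `derivable f z 1`
   for f : R[i] -> R[i] is complex differentiability.  The Riemann sphere is
   the one-point compactification of R[i] (None = infinity). *)
From HB Require Import structures.
From mathcomp Require Import all_boot all_order all_algebra.
From mathcomp Require Import complex.
From mathcomp Require Import all_classical all_reals all_analysis.
Export numFieldTopology.Exports numFieldNormedType.Exports.
Import Order.TTheory GRing.Theory Num.Theory.

Set Implicit Arguments.
Unset Strict Implicit.
Unset Printing Implicit Defensive.

Local Open Scope classical_set_scope.
Local Open Scope ring_scope.
Local Open Scope complex_scope.

HB.instance Definition _ (R : rcfType) := NormedModule.copy R[i] R[i]^o.

Section defs.
Variable R : realType.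

Definition Chat := one_point_compactification R[i].

Definition udisc : set R[i] := [set z | `|z| < 1].
Definition cudisc : set R[i] := [set z | `|z| <= 1].
Definition ucircle : set R[i] := [set z | `|z| = 1].

Definition expi (t : R) : R[i] := cos t +i* sin t.

(* finite part of a point of the sphere (oo |-> 0, only used where finite) *)
Definition fin (p : Chat) : R[i] := if p is Some w then w else 0.
(* the chart at infinity: p |-> 1/p, with 1/oo = 0 *)
Definition recip (p : Chat) : R[i] := if p is Some w then w^-1 else 0.

Definition to_sphere (A : set R[i]) : set Chat := Some @` A.

Definition cboundary (A : set R[i]) : set R[i] := closure A `\` interior A.

Definition jordan_curve (J : set R[i]) : Prop :=
  exists g : (R[i] -> R[i]),
    [/\ {within ucircle, continuous g},
        (forall x y, ucircle x -> ucircle y -> g x = g y -> x = y) &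
        g @` ucircle = J].

Definition bounded_domain (O : set R[i]) : Prop :=
  [/\ open O, connected O, O !=set0 &
      exists M : R, forall z, O z -> `|z| <= M%:C].

(* holomorphy of a map into the Riemann sphere at a point z:
   continuous at z, and complex differentiable in the chart at f z *)
Definition sphere_holomorphic_at (f : R[i] -> Chat) (z : R[i]) : Prop :=
  {for z, continuous f} /\
  (if f z is Some _ then derivable (fun u => fin (f u)) z 1
   else derivable (fun u => recip (f u)) z 1).

Definition riemann_mapping (U : set Chat) (phi : R[i] -> Chat) : Prop :=
  [/\ {within cudisc, continuous phi},
      (forall z w, cudisc z -> cudisc w -> phi z = phi w -> z = w),
      phi @` cudisc = closure U &
      (exists psi : (Chat -> R[i]),
          {within closure U, continuous psi} /\
          (forall z, cudisc z -> psi (phi z) = z))] /\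
  (* D is mapped (injectively, by the above) holomorphically onto U *)
  (phi @` udisc = U /\ (forall z, udisc z -> sphere_holomorphic_at phi z)).

Definition in_A (O : set R[i]) (f : R[i] -> R[i]) : Prop :=
  {within closure O, continuous f} /\ (forall z, O z -> derivable f z 1).

Definition supdist_le (O : set R[i]) (f g : R[i] -> R[i]) (e : R) : Prop :=
  forall z, closure O z -> `|f z - g z| <= e%:C.

Definition open_in_A (O : set R[i]) (G : set (R[i] -> R[i])) : Prop :=
  forall f, in_A O f -> G f ->
    exists2 e : R, 0 < e & forall g, in_A O g -> supdist_le O f g e -> G g.

Definition dense_in_A (O : set R[i]) (G : set (R[i] -> R[i])) : Prop :=
  forall f, in_A O f -> forall e : R, 0 < e ->
    exists g, [/\ in_A O g, G g & supdist_le O f g e].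

Definition residual_in_A (O : set R[i]) (P : set (R[i] -> R[i])) : Prop :=
  exists G : nat -> set (R[i] -> R[i]),
    (forall k, open_in_A O (G k) /\ dense_in_A O (G k)) /\
    (forall f, in_A O f -> (forall k, G k f) -> P f).

Definition nowhere_differentiable (g : R -> R) : Prop :=
  forall t : R, ~ derivable g t 1.

End defs.

(* Main.v *)
Require Import Defs.
From HB Require Import structures.
From mathcomp Require Import all_boot all_order all_algebra.
From mathcomp Require Import complex.
From mathcomp Require Import all_classical all_reals all_analysis.
From mathcomp Require Import ring lra.
Import Order.TTheory GRing.Theory Num.Theory.
Set Implicit Arguments.
Unset Strict Implicit.
Unset Printing Implicit Defensive.
Local Open Scope classical_set_scope.
Local Open Scope ring_scope.
Local Open Scope complex_scope.

(* Write phi for one of the Riemann mappings and psi for its inverse.  Adding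
   e psi^N to f changes the boundary values t |-> f (phi (e^(it))) by e e^(iNt),
   whose real and imaginary parts vary by at least e/2 on every interval of
   length pi/N, while f o phi is uniformly continuous on the circle.  So for N
   large the perturbed trace has difference quotients larger than any given k
   at every point, with a uniform margin; this property is open and dense, and
   a function having it for all k is nowhere differentiable.

   That phi maps the circle into the closure of Omega holds because the
   finitely many components V_i are closed.  That psi is holomorphic is proved
   from scratch.  Goursat's lemma on rectangles, together with the
   removability of isolated points of non-differentiability of a continuous
   function, gives Cauchy's formula on squares; hence such points are points of
   differentiability and zeros have finite order, so phi' has isolated zeros.
   Then psi is continuous and differentiable off isolated points, hence
   everywhere. *)

(** * The complex plane with a real-valued modulus *)

Section complex_plane.
Variable R : realType.
Implicit Types (z w a b : R[i]) (x y t : R).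
Local Notation C := R[i].
Local Notation nm := (@Normc.normc R).
Local Notation Re := (@complex.Re R).
Local Notation Im := (@complex.Im R).

(** The definition of a Riemann mapping makes [phi] holomorphic but its inverse only continuous,
    whereas the perturbed function has to lie in A(Omega); this obstacle accounts for most of the
    length. Holomorphy means pointwise differentiability, with no continuity of the derivative, so
    the theory has to start from Goursat's bisection. Integrals are taken with primitives on the
    whole line, so functions known only near a point are first extended continuously to the plane by
    clamping the coordinates. The conditions are indexed by a level [k], a boundary curve [i] and a
    choice of real or imaginary part. Each involves one curve only, so the perturbation made for
    index [i] may behave arbitrarily on the other curves. Its norm is at most [e] because
    [|psi| <= 1] on the closure of Omega. *)

Lemma normr_normc z : `|z| = (nm z)%:C.
Proof. by []. Qed.

Lemma normc_ge0 z : 0 <= nm z.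
Proof. by case: z => x y; rewrite sqrtr_ge0. Qed.

Lemma normc_eq0 z : (nm z == 0) = (z == 0).
Proof.
by apply/eqP/eqP => [/Normc.eq0_normc//|->]; rewrite Normc.normc0.
Qed.

Lemma normc_gt0 z : (0 < nm z) = (z != 0).
Proof. by rewrite lt_def normc_ge0 andbT normc_eq0. Qed.

Lemma normcX z n : nm (z ^+ n) = nm z ^+ n.
Proof. by elim: n => [|n IH]; rewrite ?expr0 ?Normc.normc1// !exprS Normc.normcM IH. Qed.

Lemma ler_normc_Re z : `|Re z| <= nm z.
Proof.
case: z => x y /=; rewrite -[`|x|]sqrtr_sqr ler_sqrt ?lerDl ?sqr_ge0//.
by rewrite addr_ge0 ?sqr_ge0.
Qed.

Lemma ler_normc_Im z : `|Im z| <= nm z.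
Proof.
case: z => x y /=; rewrite -[`|y|]sqrtr_sqr ler_sqrt ?lerDr ?sqr_ge0//.
by rewrite addr_ge0 ?sqr_ge0.
Qed.

Lemma normc_le_ReIm z : nm z <= `|Re z| + `|Im z|.
Proof.
case: z => x y /=; rewrite -[leRHS]ger0_norm ?addr_ge0// -sqrtr_sqr ler_sqrt ?sqr_ge0//.
rewrite sqrrD !real_normK ?num_real// lerD2r lerDl.
by rewrite mulrn_wge0// mulr_ge0.
Qed.

Lemma normcB z w : nm (z - w) = nm (w - z).
Proof. by rewrite -normcN opprB. Qed.

Lemma normc_real x : nm x%:C = `|x|.
Proof. by rewrite /= expr0n addr0 sqrtr_sqr. Qed.

Lemma nbhs_normcP z (A : set C) :
  nbhs z A <-> exists2 d : R, 0 < d & forall w, nm (w - z) < d -> A w.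
Proof.
split=> [/nbhs_ballP[e /= e0 sA]|[d d0 dA]].
  have eE : e = (Re e)%:C.
    by move: e0; rewrite ltcE => /andP[/eqP] /=; case: (e) => ? ? /= ->.
  have Re0 : 0 < Re e by move: e0; rewrite ltcE => /andP[_].
  exists (Re e) => // w wz; apply: sA.
  by rewrite -ball_normE /= normr_normc eE ltcR normcB.
apply/nbhs_ballP; exists d%:C => /=; first by rewrite ltcR.
by move=> w; rewrite -ball_normE /= normr_normc ltcR normcB => /dA.
Qed.

Lemma continuous_normcP (f : C -> C) z :
  {for z, continuous f} <-> forall e : R, 0 < e ->
    exists2 d : R, 0 < d & forall w, nm (w - z) < d -> nm (f w - f z) < e.
Proof.
split=> [cf e e0|H A /nbhs_normcP[e e0 eA]].
  have /cf/nbhs_normcP[d d0 dA] : nbhs (f z) [set w | nm (w - f z) < e].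
    by apply/nbhs_normcP; exists e.
  by exists d.
have [d d0 dA] := H _ e0; apply/nbhs_normcP; exists d => // w /dA.
exact: eA.
Qed.

(** Carathéodory's difference quotient, completed by [l] at [a]: differentiability at [a] becomes
    continuity there. It also serves to divide out a zero and as the integrand behind Cauchy's
    formula. *)
Definition slope (f : C -> C) a l z : C := if z == a then l else (f z - f a) / (z - a).

Lemma slopeE f a l z : f z = f a + (z - a) * slope f a l z.
Proof.
rewrite /slope; case: eqVneq => [->|za]; first by rewrite subrr mul0r addr0.
by rewrite mulrC divfK ?subr_eq0// addrC subrK.
Qed.

Lemma derivable_slopeP (f : C -> C) a l :
  is_derive a (1 : C) f l <-> {for a, continuous (slope f a l)}.
Proof.
have -> : is_derive a (1 : C) f l <-> (h^-1 *: (f (h *: 1 + a) - f a)) @[h --> (0:C)^'] --> l.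
  split=> [[d <-]|h]; first exact: d.
  by split; [apply/cvg_ex; exists l | apply/cvg_lim].
split.
  move=> H A; rewrite {1}/slope eqxx => Al; have /= := H _ Al.
  rewrite /nbhs /= /dnbhs /within /= => /nbhs_normcP[d d0 dA].
  apply/nbhs_normcP; exists d => // w wa; rewrite /= /slope.
  case: eqVneq => [wa0|nwa]; first exact: nbhs_singleton Al.
  have := dA (w - a); rewrite subr0 => /(_ wa).
  rewrite subr_eq0 => /(_ nwa).
  by rewrite /GRing.scale /= mulr1 subrK mulrC.
move=> H A Al; have /= := H A; rewrite {1}/slope eqxx => /(_ Al)/nbhs_normcP[d d0 dA].
rewrite /nbhs /= /dnbhs /within /=; apply/nbhs_normcP; exists d => // w.
rewrite subr0 => wd w0; have := dA (w + a); rewrite addrK => /(_ wd).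
rewrite /= /slope; rewrite -subr_eq0 addrK (negPf w0) /=.
by rewrite /GRing.scale /= mulr1 mulrC.
Qed.

Lemma continuous_fD (f g : C -> C) z :
  {for z, continuous f} -> {for z, continuous g} -> {for z, continuous (fun w => f w + g w)}.
Proof. by move=> cf cg; exact: (@continuousD _ _ _ f g z cf cg). Qed.

Lemma continuous_fM (f g : C -> C) z :
  {for z, continuous f} -> {for z, continuous g} -> {for z, continuous (fun w => f w * g w)}.
Proof. by move=> cf cg; exact: (@continuousM _ _ f g z cf cg). Qed.

Lemma continuous_fV (f : C -> C) z :
  f z != 0 -> {for z, continuous f} -> {for z, continuous (fun w => (f w)^-1)}.
Proof. by move=> f0 cf; exact: (@continuousV _ _ f z f0 cf). Qed.

Lemma continuous_subC a z : {for z, continuous (fun w => w - a)}.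
Proof.
by apply: (@continuous_fD (fun w => w) (fun=> - a)); [move=> A; exact|exact: cst_continuous].
Qed.

Lemma is_derive_continuous (f : C -> C) z l : is_derive z (1 : C) f l -> {for z, continuous f}.
Proof. by move=> [d _]; apply/differentiable_continuous/derivable1_diffP. Qed.

Lemma is_derive_fD (f g : C -> C) z df dg :
  is_derive z (1 : C) f df -> is_derive z (1 : C) g dg ->
  is_derive z (1 : C) (fun w => f w + g w) (df + dg).
Proof. by move=> cf cg; exact: (@is_deriveD _ _ _ f g z 1 _ _ cf cg). Qed.

Lemma is_derive_fM (f g : C -> C) z df dg :
  is_derive z (1 : C) f df -> is_derive z (1 : C) g dg ->
  is_derive z (1 : C) (fun w => f w * g w) (f z * dg + g z * df).
Proof. by move=> cf cg; exact: (@is_deriveM _ _ f g z 1 _ _ cf cg). Qed.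

Lemma is_derive_fV (f : C -> C) z df : f z != 0 ->
  is_derive z (1 : C) f df -> is_derive z (1 : C) (fun w => (f w)^-1) (- df / f z ^+ 2).
Proof.
move=> f0 df0; apply: DeriveDef; first by apply: (@derivableV _ _ f z 1).
rewrite (@deriveV _ _ f z 1)// derive_val /GRing.scale /=; ring.
Qed.

Lemma is_derive_fshift a z : is_derive z (1 : C) (fun w => w - a) 1.
Proof.
by rewrite -[1 in X in is_derive _ _ _ X]addr0; exact: (@is_derive_fD id (cst (- a))).
Qed.

End complex_plane.

(** * Integrals of complex-valued functions of a real variable *)

Section integral.
Variable R : realType.
Implicit Types (f g : R -> R) (a b c t x y A : R) (G H : R -> R[i]).
Local Notation C := R[i].
Local Notation nm := (@Normc.normc R).
Local Notation Re := (@complex.Re R).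
Local Notation Im := (@complex.Im R).
Local Notation mu := (@lebesgue_measure R).

(** The fundamental theorem of calculus applies to the integral [F A] from a fixed left end [- A].
    The integral [P] from 0 equals [F A - F A 0] near [x] when [A = |x| + 1]. *)
Lemma primitive_exists g : continuous g -> exists P : R -> R, forall x : R, is_derive x (1:R) P (g x).
Proof.
move=> cg.
pose F A x := (\int[mu]_(t in `[- A, x]) g t)%R.
have ig a b : mu.-integrable `[a, b] (EFin \o g).
  apply: continuous_compact_integrable; first exact: segment_compact.
  exact: continuous_subspaceT.
have dF A x : - A < x -> is_derive x (1:R) (F A) (g x).
  move=> Ax.
  have [] := @continuous_FTC1_closed R g (- A) x (x + 1) _ (ig _ _) Ax (cg x).
    by rewrite ltrDl.
  move=> d1; rewrite derive1E => d2; apply: DeriveDef.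
    exact: d1.
  exact: d2.
pose P x := if 0 <= x then (\int[mu]_(t in `]0, x]) g t)%R else - (\int[mu]_(t in `]x, 0]) g t)%R.
have PF A x : 0 < A -> - A < x -> P x = F A x - F A 0.
  move=> A0 Ax; rewrite /P; case: (leP 0 x) => x0.
    by rewrite /F Rintegral_itvB//; rewrite bnd_simp// oppr_le0 ltW.
  by rewrite -opprB /F Rintegral_itvB//; rewrite bnd_simp// ltW.
exists P => x; pose A := `|x| + 1.
have A0 : 0 < A by rewrite ltr_wpDl.
have Ax : - A < x by rewrite /A; have := ler_norm (- x); rewrite normrN; lra.
apply: (@near_eq_is_derive _ _ _ (fun y => F A y - F A 0)).
  near=> y; rewrite (@PF A)//; near: y; exact: lt_nbhsr.
have -> : g x = g x - 0 by rewrite subr0.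
apply: (@is_deriveB _ _ _ (F A) (cst (F A 0))); first exact: dF.
Unshelve. all: by end_near. Qed.

(** A chosen primitive, the zero function if there is none; [rint_FTC] makes the choice
    immaterial. *)
Definition primitive g : R -> R :=
  xget (fun=> 0) [set P : R -> R | forall x : R, is_derive x (1:R) P (g x)].

(* Signed, so that splitting an integral needs no order between the endpoints. *)
Definition rint g a b := primitive g b - primitive g a.

Lemma is_derive_primitive g P : (forall x : R, is_derive x (1:R) P (g x)) ->
  forall x : R, is_derive x (1:R) (primitive g) (g x).
Proof. by move=> PP; rewrite /primitive; case: xgetP => [? -> //|/(_ P)]. Qed.

Lemma rint_FTC g P a b : (forall x : R, is_derive x (1:R) P (g x)) -> rint g a b = P b - P a.
Proof.
move=> PP; have := is_derive_primitive PP => PG.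
have : forall x : R, is_derive x (1:R) (P - primitive g) 0.
  by move=> x; rewrite -(subrr (g x)); exact: is_deriveB.
move=> /(is_derive_0_is_cst a b); rewrite /rint !fctE => h.
by move: h; lra.
Qed.

(** Source of both kinds of estimate: the upper bound [rint_norm_le] and the lower bound
    [cint_Im_ge]. *)
Lemma rint_mean_value g a b : continuous g -> a <= b ->
  exists2 c, a <= c <= b & rint g a b = g c * (b - a).
Proof.
move=> /primitive_exists[P PP] ab; rewrite (rint_FTC _ _ PP).
have cP : {within `[a, b], continuous P}.
  apply: continuous_subspaceT => x.
  by apply/differentiable_continuous/derivable1_diffP; have [] := PP x.
have [c] := MVT_segment ab (fun x _ => PP x) cP.
by rewrite in_itv /= => cab ->; exists c.
Qed.

Lemma rint_swap g a b : rint g a b = - rint g b a.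
Proof. by rewrite /rint opprB. Qed.

Lemma rint_norm_le g a b M : continuous g ->
  (forall t, Num.min a b <= t <= Num.max a b -> `|g t| <= M) ->
  `|rint g a b| <= M * `|b - a|.
Proof.
move=> cg; wlog ab : a b / a <= b.
  move=> W gm; case: (leP a b) => [|/ltW] ab; first exact: W.
  rewrite rint_swap normrN (distrC b); apply: W => // t.
  by rewrite minC maxC; exact: gm.
rewrite min_l// max_r// => gm; have [c cab ->] := rint_mean_value cg ab.
by rewrite normrM ler_wpM2r// gm.
Qed.

Definition cint G a b : C := rint (fun t => Re (G t)) a b +i* rint (fun t => Im (G t)) a b.

Definition ccontinuous G :=
  continuous (fun t => Re (G t)) /\ continuous (fun t => Im (G t)).

Lemma ccontinuousZ (l : C) G : ccontinuous G -> ccontinuous (fun t => l * G t).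
Proof.
move=> [c1 c2]; case: l => l1 l2; split.
  have -> : (fun t : R => Re ((l1 +i* l2) * G t)) = (fun t => l1 * Re (G t) + (- l2) * Im (G t)).
    by apply/funext => t; case: (G t) => ? ? /=; ring.
  move=> t; apply: (@continuousD _ R^o _ (fun t => l1 * Re (G t)) (fun t => (- l2) * Im (G t))).
    by apply: (@continuousM _ _ (fun=> l1) (fun t => Re (G t))); [exact: cst_continuous|exact: c1].
  by apply: (@continuousM _ _ (fun=> - l2) (fun t => Im (G t))); [exact: cst_continuous|exact: c2].
have -> : (fun t : R => Im ((l1 +i* l2) * G t)) = (fun t => l1 * Im (G t) + l2 * Re (G t)).
  by apply/funext => t; case: (G t) => ? ? /=; ring.
move=> t; apply: (@continuousD _ R^o _ (fun t => l1 * Im (G t)) (fun t => l2 * Re (G t))).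
  by apply: (@continuousM _ _ (fun=> l1) (fun t => Im (G t))); [exact: cst_continuous|exact: c2].
by apply: (@continuousM _ _ (fun=> l2) (fun t => Re (G t))); [exact: cst_continuous|exact: c1].
Qed.

Lemma cint_FTC G (F1 F2 : R -> R) a b :
  (forall x : R, is_derive x (1:R) F1 (Re (G x))) -> (forall x : R, is_derive x (1:R) F2 (Im (G x))) ->
  cint G a b = (F1 b - F1 a) +i* (F2 b - F2 a).
Proof. by move=> h1 h2; rewrite /cint (rint_FTC _ _ h1) (rint_FTC _ _ h2). Qed.

Lemma cint_split G a b c : cint G a b = cint G a c + cint G c b.
Proof. by rewrite /cint /rint; apply/eqP; rewrite eq_complex /=; apply/andP; split; apply/eqP; ring. Qed.

Lemma cintD G H a b : ccontinuous G -> ccontinuous H ->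
  cint (fun t => G t + H t) a b = cint G a b + cint H a b.
Proof.
move=> [/primitive_exists[P1 h1] /primitive_exists[P2 h2]].
move=> [/primitive_exists[Q1 k1] /primitive_exists[Q2 k2]].
have l1 x : is_derive x (1:R) (P1 + Q1) (Re (G x + H x)).
  have -> : Re (G x + H x) = Re (G x) + Re (H x) by case: (G x) (H x) => ? ? [].
  exact: is_deriveD.
have l2 x : is_derive x (1:R) (P2 + Q2) (Im (G x + H x)).
  have -> : Im (G x + H x) = Im (G x) + Im (H x) by case: (G x) (H x) => ? ? [].
  exact: is_deriveD.
rewrite (cint_FTC a b h1 h2) (cint_FTC a b k1 k2).
rewrite (@cint_FTC (fun t => G t + H t) _ _ a b l1 l2).
by apply/eqP; rewrite eq_complex /= !fctE; apply/andP; split; apply/eqP; ring.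
Qed.

Lemma cintZ (k : C) G a b : ccontinuous G ->
  cint (fun t => k * G t) a b = k * cint G a b.
Proof.
move=> [/primitive_exists[P1 h1] /primitive_exists[P2 h2]].
case: k => k1 k2.
have l1 x : is_derive x (1:R) (fun y => k1 * P1 y - k2 * P2 y) (Re ((k1 +i* k2) * G x)).
  have -> : Re ((k1 +i* k2) * G x) = k1 *: Re (G x) - k2 *: Im (G x) by case: (G x) => ? ?.
  apply: (@is_deriveB _ _ _ (k1 \*: P1) (k2 \*: P2)); exact: is_deriveZ.
have l2 x : is_derive x (1:R) (fun y => k1 * P2 y + k2 * P1 y) (Im ((k1 +i* k2) * G x)).
  have -> : Im ((k1 +i* k2) * G x) = k1 *: Im (G x) + k2 *: Re (G x) by case: (G x) => ? ?.
  apply: (@is_deriveD _ _ _ (k1 \*: P2) (k2 \*: P1)); exact: is_deriveZ.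
rewrite (cint_FTC a b h1 h2) (@cint_FTC (fun t => (k1 +i* k2) * G t) _ _ a b l1 l2).
apply/eqP; rewrite eq_complex /=.
by apply/andP; split; apply/eqP; ring.
Qed.

(** The factor 2 comes from bounding the real and imaginary parts separately. *)
Lemma cint_norm_le G a b M : ccontinuous G ->
  (forall t, Num.min a b <= t <= Num.max a b -> nm (G t) <= M) ->
  nm (cint G a b) <= 2 * M * `|b - a|.
Proof.
move=> [c1 c2] GM; apply: le_trans (normc_le_ReIm _) _ => /=.
rewrite -mulrA mulr_natl mulr2n; apply: lerD; apply: rint_norm_le => // t /GM.
  exact: le_trans (ler_normc_Re _).
exact: le_trans (ler_normc_Im _).
Qed.

Lemma cint_Im_ge G a b m : ccontinuous G -> a <= b ->
  (forall t, a <= t <= b -> m <= Im (G t)) -> m * (b - a) <= Im (cint G a b).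
Proof.
move=> [_ c2] ab mG; have [c cab E] := rint_mean_value c2 ab.
by rewrite /cint /= E ler_wpM2r ?subr_ge0// mG.
Qed.

End integral.

(** * Goursat's lemma *)

Section rectangle.
Variable R : realType.
Local Notation C := R[i].
Local Notation nm := (@Normc.normc R).
Local Notation Re := (@complex.Re R).
Local Notation Im := (@complex.Im R).
Implicit Types (f g : C -> C) (x y t : R) (z w : C).

Lemma complex_split x y : x +i* y = x%:C + 'i%C * y%:C.
Proof. by rewrite [LHS]complexE. Qed.

Lemma ReB z w : Re (z - w) = Re z - Re w.
Proof. by case: z w => ? ? []. Qed.

Lemma ImB z w : Im (z - w) = Im z - Im w.
Proof. by case: z w => ? ? []. Qed.

Lemma continuous_ccontinuous (G : R -> C) : continuous G -> ccontinuous G.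
Proof.
move=> cG; split=> t A /nbhs_ballP[e /= e0 eA].
- have /cG : nbhs (G t) [set w | nm (w - G t) < e] by apply/nbhs_normcP; exists e.
  move=> H; apply: (@filterS _ (nbhs t) _ _ _ _ H) => s /= se; apply: eA; rewrite -ball_normE /=.
  by rewrite distrC -ReB (le_lt_trans (ler_normc_Re _)).
- have /cG : nbhs (G t) [set w | nm (w - G t) < e] by apply/nbhs_normcP; exists e.
  move=> H; apply: (@filterS _ (nbhs t) _ _ _ _ H) => s /= se; apply: eA; rewrite -ball_normE /=.
  by rewrite distrC -ImB (le_lt_trans (ler_normc_Im _)).
Qed.

Lemma continuous_hline y : continuous (fun t => t +i* y : C).
Proof.
move=> t A /nbhs_normcP[d d0 dA]; apply/nbhs_ballP; exists d => //= s.
rewrite -ball_normE /= => ts; apply: dA.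
have -> : s +i* y - t +i* y = (s - t)%:C by apply/eqP; rewrite eq_complex /= subrr !eqxx.
by rewrite normc_real distrC.
Qed.

Lemma continuous_vline x : continuous (fun t => x +i* t : C).
Proof.
move=> t A /nbhs_normcP[d d0 dA]; apply/nbhs_ballP; exists d => //= s.
rewrite -ball_normE /= => ts; apply: dA.
rewrite (le_lt_trans (normc_le_ReIm _))//= subrr normr0 add0r.
by rewrite distrC.
Qed.

Definition hseg f y t := f (t +i* y).
Definition vseg f x t := f (x +i* t).

Lemma ccontinuous_hseg f y : (forall t, {for t +i* y, continuous f}) -> ccontinuous (hseg f y).
Proof.
move=> cf; apply: continuous_ccontinuous => t.
by apply: (@continuous_comp _ _ _ (fun t => t +i* y)); [exact: continuous_hline|exact: cf].
Qed.

Lemma ccontinuous_vseg f x : (forall t, {for x +i* t, continuous f}) -> ccontinuous (vseg f x).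
Proof.
move=> cf; apply: continuous_ccontinuous => t.
by apply: (@continuous_comp _ _ _ (fun t => x +i* t)); [exact: continuous_vline|exact: cf].
Qed.

(** The contour integral, counterclockwise when [x0 <= x1] and [y0 <= y1]. Since the side integrals
    are signed, the corners may come in any order and a rectangle may be split at any coordinate. *)
Definition rectint f x0 x1 y0 y1 : C :=
  cint (hseg f y0) x0 x1 - cint (hseg f y1) x0 x1 +
  'i%C * (cint (vseg f x1) y0 y1 - cint (vseg f x0) y0 y1).

(** Continuity is asked along the full lines through the sides, because [primitive] refers to a
    primitive on all of the real line. *)
Definition edge_continuous f x0 x1 y0 y1 :=
  [/\ ccontinuous (hseg f y0), ccontinuous (hseg f y1),
      ccontinuous (vseg f x0) & ccontinuous (vseg f x1)].

Lemma edge_continuousT f x0 x1 y0 y1 : continuous f -> edge_continuous f x0 x1 y0 y1.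
Proof.
by move=> cf; split; (apply: ccontinuous_hseg || apply: ccontinuous_vseg) => t; exact: cf.
Qed.

Lemma rectint_splitx f c x0 x1 y0 y1 :
  rectint f x0 x1 y0 y1 = rectint f x0 c y0 y1 + rectint f c x1 y0 y1.
Proof.
rewrite /rectint (cint_split (hseg f y0) x0 x1 c) (cint_split (hseg f y1) x0 x1 c).
ring.
Qed.

Lemma rectint_splity f c x0 x1 y0 y1 :
  rectint f x0 x1 y0 y1 = rectint f x0 x1 y0 c + rectint f x0 x1 c y1.
Proof.
rewrite /rectint (cint_split (vseg f x0) y0 y1 c) (cint_split (vseg f x1) y0 y1 c).
ring.
Qed.

Lemma rectintD f g x0 x1 y0 y1 :
  edge_continuous f x0 x1 y0 y1 -> edge_continuous g x0 x1 y0 y1 ->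
  rectint (fun z => f z + g z) x0 x1 y0 y1 = rectint f x0 x1 y0 y1 + rectint g x0 x1 y0 y1.
Proof.
move=> [f1 f2 f3 f4] [g1 g2 g3 g4]; rewrite /rectint.
have -> : hseg (fun z => f z + g z) y0 = fun t => hseg f y0 t + hseg g y0 t by [].
have -> : hseg (fun z => f z + g z) y1 = fun t => hseg f y1 t + hseg g y1 t by [].
have -> : vseg (fun z => f z + g z) x0 = fun t => vseg f x0 t + vseg g x0 t by [].
have -> : vseg (fun z => f z + g z) x1 = fun t => vseg f x1 t + vseg g x1 t by [].
by rewrite !cintD//; ring.
Qed.

Lemma rectintZ (k : C) f x0 x1 y0 y1 : edge_continuous f x0 x1 y0 y1 ->
  rectint (fun z => k * f z) x0 x1 y0 y1 = k * rectint f x0 x1 y0 y1.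
Proof.
move=> [f1 f2 f3 f4]; rewrite /rectint.
have -> : hseg (fun z => k * f z) y0 = fun t => k * hseg f y0 t by [].
have -> : hseg (fun z => k * f z) y1 = fun t => k * hseg f y1 t by [].
have -> : vseg (fun z => k * f z) x0 = fun t => k * vseg f x0 t by [].
have -> : vseg (fun z => k * f z) x1 = fun t => k * vseg f x1 t by [].
by rewrite !cintZ//; ring.
Qed.

Definition in_range (a b t : R) := Num.min a b <= t <= Num.max a b.

Lemma in_rangel a b : in_range a b a.
Proof. by rewrite /in_range ge_min le_max lexx. Qed.

Lemma in_ranger a b : in_range a b b.
Proof. by rewrite /in_range ge_min le_max lexx !orbT. Qed.

Lemma in_range_sym (r t : R) : 0 < r -> in_range (- r) r t = (`|t| <= r).
Proof.
move=> r0; have h : - r <= r by lra.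
by rewrite /in_range ler_norml (min_l h) (max_r h).
Qed.

Lemma rectint_norm_le f x0 x1 y0 y1 M : edge_continuous f x0 x1 y0 y1 ->
  (forall x y, in_range x0 x1 x -> in_range y0 y1 y ->
     [|| x == x0, x == x1, y == y0 | y == y1] -> nm (f (x +i* y)) <= M) ->
  nm (rectint f x0 x1 y0 y1) <= 4 * M * (`|x1 - x0| + `|y1 - y0|).
Proof.
move=> [f1 f2 f3 f4] fM.
have h1 : nm (cint (hseg f y0) x0 x1) <= 2 * M * `|x1 - x0|.
  by apply: cint_norm_le => // t tx; apply: fM; rewrite ?in_rangel ?eqxx ?orbT.
have h2 : nm (cint (hseg f y1) x0 x1) <= 2 * M * `|x1 - x0|.
  by apply: cint_norm_le => // t tx; apply: fM; rewrite ?in_ranger ?eqxx ?orbT.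
have h3 : nm (cint (vseg f x0) y0 y1) <= 2 * M * `|y1 - y0|.
  by apply: cint_norm_le => // t tx; apply: fM; rewrite ?in_rangel ?eqxx ?orbT.
have h4 : nm (cint (vseg f x1) y0 y1) <= 2 * M * `|y1 - y0|.
  by apply: cint_norm_le => // t tx; apply: fM; rewrite ?in_ranger ?eqxx ?orbT.
rewrite /rectint; apply: le_trans (le_normcD _ _) _.
rewrite Normc.normcM.
have -> : nm 'i%C = 1 by rewrite /= expr0n expr1n add0r sqrtr1.
have k1 := le_normcD (cint (hseg f y0) x0 x1) (- cint (hseg f y1) x0 x1).
have k2 := le_normcD (cint (vseg f x1) y0 y1) (- cint (vseg f x0) y0 y1).
rewrite !normcN in k1 k2; rewrite mul1r.
have e : 4 * M * (`|x1 - x0| + `|y1 - y0|) = 2 * M * `|x1 - x0| + 2 * M * `|x1 - x0| +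
   (2 * M * `|y1 - y0| + 2 * M * `|y1 - y0|) by ring.
by rewrite e; lra.
Qed.

Lemma cint_affine (k l : C) (a b : R) :
  cint (fun t => k + l * t%:C) a b = (b - a)%:C * k + ((b ^+ 2 - a ^+ 2) / 2)%:C * l.
Proof.
have dq (u v x : R) : is_derive x (1:R) (fun t : R => u * t + v * (t ^+ 2 / 2)) (u + v * x).
  have -> : (fun t : R => u * t + v * (t ^+ 2 / 2)) = horner (u *: 'X + (v / 2) *: 'X^2).
    by apply/funext => t; rewrite hornerD !hornerZ hornerX hornerXn; field.
  apply: is_derive_eq; rewrite derivD !derivZ derivX derivXn hornerD !hornerZ hornerMn hornerXn hornerC /=; by field.
case: k l => [k1 k2] [l1 l2].
have h1 x : is_derive x (1:R) (fun t : R => k1 * t + l1 * (t ^+ 2 / 2)) (Re ((k1 +i* k2) + (l1 +i* l2) * x%:C)).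
  by apply: is_derive_eq; rewrite /= mulr0 subr0.
have h2 x : is_derive x (1:R) (fun t : R => k2 * t + l2 * (t ^+ 2 / 2)) (Im ((k1 +i* k2) + (l1 +i* l2) * x%:C)).
  by apply: is_derive_eq; rewrite /= mulr0 add0r.
rewrite (@cint_FTC R (fun t => (k1 +i* k2) + (l1 +i* l2) * t%:C) _ _ a b h1 h2).
by apply/eqP; rewrite eq_complex /=; apply/andP; split; apply/eqP; field.
Qed.

(** Each side integral of an affine function is explicit, and the four cancel. Goursat's lemma
    compares [f] with such a function. *)
Lemma rectint_affine (k l : C) x0 x1 y0 y1 : rectint (fun z => k + l * z) x0 x1 y0 y1 = 0.
Proof.
have hE y : hseg (fun z => k + l * z) y = fun t => (k + l * ('i%C * y%:C)) + l * t%:C.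
  by apply/funext => t; rewrite /hseg complex_split; ring.
have vE x : vseg (fun z => k + l * z) x = fun t => (k + l * x%:C) + (l * 'i%C) * t%:C.
  by apply/funext => t; rewrite /vseg complex_split; ring.
rewrite /rectint !hE !vE !cint_affine.
rewrite !(rmorphB (real_complex R)) /=; ring.
Qed.

End rectangle.

#[local] Arguments Normc.normc : simpl never.

Section goursat.
Variable R : realType.
Local Notation C := R[i].
Local Notation nm := (@Normc.normc R).
Local Notation Re := (@complex.Re R).
Local Notation Im := (@complex.Im R).
Implicit Types (f g : C -> C) (x y t : R) (z w : C).

Lemma derivable_affine_bound f z l : is_derive z (1 : C) f l ->
  forall e : R, 0 < e -> exists2 d : R, 0 < d &
    forall w, nm (w - z) < d -> nm (f w - (f z + l * (w - z))) <= e * nm (w - z).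
Proof.
move=> /derivable_slopeP/continuous_normcP H e e0; have [d d0 dH] := H e e0.
exists d => // w /dH /ltW; rewrite {2}/slope eqxx => h.
have -> : f w - (f z + l * (w - z)) = (slope f z l w - l) * (w - z).
  by rewrite (slopeE f z l w); ring.
by rewrite Normc.normcM ler_wpM2r ?normc_ge0.
Qed.

(** The common point is the supremum of the left ends, for which every right end is an upper
    bound. *)
Lemma nested_dyadic (p : nat -> R) :
  (forall n, p n <= p n.+1 /\ p n.+1 + 2^-1 ^+ n.+1 <= p n + 2^-1 ^+ n) ->
  exists q, forall n, p n <= q <= p n + 2^-1 ^+ n.
Proof.
move=> H.
have up m n : (m <= n)%N -> p m <= p n /\ p n + 2^-1 ^+ n <= p m + 2^-1 ^+ m.
  elim: n => [|n IH]; first by rewrite leqn0 => /eqP ->.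
  rewrite leq_eqVlt => /orP[/eqP ->//|]; rewrite ltnS => /IH [h1 h2].
  have [k1 k2] := H n; split; first exact: le_trans k1.
  exact: le_trans h2.
have pos n : (0 : R) <= 2^-1 ^+ n by rewrite exprn_ge0.
have ub n m : p m <= p n + 2^-1 ^+ n.
  case: (leqP m n) => [/up[h _]|/ltnW/up[_ h]]; first by have := pos n; lra.
  by have := pos m; lra.
exists (sup (range p)) => n; apply/andP; split.
  apply: ub_le_sup; last by exists n.
  by exists (p 0%N + 2^-1 ^+ 0) => _ [m _ <-].
apply: ge_sup; first by exists (p 0%N); exists 0%N.
by move=> _ [m _ <-].
Qed.

(** Dependent choice with an invariant [P] on states and a relation [Q] between successive ones; it
    produces the nested rectangles of Goursat's lemma. *)
Lemma dependent_seq (T : pointedType) (P : nat -> T -> Prop) (Q : nat -> T -> T -> Prop) s0 :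
  P 0%N s0 -> (forall n s, P n s -> exists2 s', P n.+1 s' & Q n s s') ->
  exists s : nat -> T, s 0%N = s0 /\ forall n, P n (s n) /\ Q n (s n) (s n.+1).
Proof.
move=> P0 H; pose nxt n s := xget s [set s' | P n.+1 s' /\ Q n s s'].
pose s := fix s n := if n is m.+1 then nxt m (s m) else s0.
have nxtP n u : P n u -> P n.+1 (nxt n u) /\ Q n u (nxt n u).
  move=> /H[u' h1 h2]; rewrite /nxt; case: xgetP => [? -> //|/(_ u')].
  by case; split.
have Ps n : P n (s n) by elim: n => [//|n /nxtP[]].
by exists s; split => // n; split => //; have [] := nxtP n _ (Ps n).
Qed.

Lemma dyadic_lt (e : R) : 0 < e -> exists n, (2^-1 : R) ^+ n < e.
Proof.
move=> e0.
have /(cvgrPdist_lt _ _).1 /(_ _ e0) [n _ /(_ n (leqnn n))] : ((2^-1 : R) ^+ k) @[k --> \oo] --> (0 : R).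
  by apply: cvg_expr; rewrite ger0_norm; lra.
by rewrite sub0r normrN ger0_norm ?exprn_ge0//; exists n.
Qed.

Lemma in_range_mix (a b p : R) : 0 <= p <= 1 -> in_range a b (a + (b - a) * p).
Proof.
move=> /andP[p0 p1]; rewrite /in_range ge_min le_max.
case: (leP a b) => ab.
  have h1 : 0 <= (b - a) * p by rewrite mulr_ge0// subr_ge0.
  have h2 : 0 <= (b - a) * (1 - p) by rewrite mulr_ge0 ?subr_ge0.
  by apply/andP; split; apply/orP; [left|right]; lra.
have h1 : 0 <= (a - b) * p by rewrite mulr_ge0// subr_ge0 ltW.
have h2 : 0 <= (a - b) * (1 - p) by rewrite mulr_ge0 ?subr_ge0// ltW.
by apply/andP; split; apply/orP; [right|left]; lra.
Qed.

Lemma in_range_dist (a l p h q t : R) : 0 <= h -> p <= q <= p + h ->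
  in_range (a + l * p) (a + l * (p + h)) t -> `|t - (a + l * q)| <= `|l| * h.
Proof.
move=> h0 /andP[q1 q2]; rewrite /in_range ge_min le_max => /andP[/orP t1 /orP t2].
rewrite ler_norml; case: (lerP 0 l) => l0.
  have h1 : 0 <= l * (q - p) by rewrite mulr_ge0// subr_ge0.
  have h2 : 0 <= l * (p + h - q) by rewrite mulr_ge0// subr_ge0.
  have h3 : 0 <= l * h by rewrite mulr_ge0.
  rewrite (ger0_norm l0); by apply/andP; split; case: t1; case: t2; lra.
have h1 : 0 <= - l * (q - p) by rewrite mulr_ge0// ?subr_ge0// oppr_ge0 ltW.
have h2 : 0 <= - l * (p + h - q) by rewrite mulr_ge0// ?subr_ge0// oppr_ge0 ltW.
have h3 : 0 <= - l * h by rewrite mulr_ge0// oppr_ge0 ltW.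
rewrite (ltr0_norm l0); by apply/andP; split; case: t1; case: t2; lra.
Qed.

Lemma continuous_affine (k l : C) : continuous (fun z : C => k + l * z).
Proof.
move=> z; apply/continuous_normcP => e e0; exists (e / (nm l + 1)).
  by rewrite divr_gt0// ltr_wpDl// normc_ge0.
move=> w; rewrite ltr_pdivlMr ?ltr_wpDl ?normc_ge0// => h.
have -> : k + l * w - (k + l * z) = l * (w - z) by ring.
rewrite Normc.normcM; apply: le_lt_trans h.
by have := normc_ge0 (w - z); have := normc_ge0 l; nra.
Qed.

(** If the integral has modulus [c > 0], bisection yields nested rectangles of relative size
    [h = 2^-n] whose integrals have modulus at least [c h^2]. At their common point [f] is affine up
    to [e] times the distance, which bounds these integrals by [4 e La^2 h^2], with [La] the sum of
    the two side lengths. A small [e] gives a contradiction. *)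
Lemma goursat f x0 x1 y0 y1 : continuous f ->
  (forall x y, in_range x0 x1 x -> in_range y0 y1 y -> derivable f (x +i* y) 1) ->
  rectint f x0 x1 y0 y1 = 0.
Proof.
move=> cf df; apply/eqP; rewrite -normc_eq0; apply/negPn/negP => I0.
set c := nm _ in I0; have {I0}c0 : 0 < c by rewrite lt_def I0 normc_ge0.
pose l1 := x1 - x0; pose l2 := y1 - y0.
(* Sub-rectangles are described in unit-square coordinates: [l1] and [l2] may be negative or zero,
   while [p], [q] and [h] stay in [0, 1]. *)
pose J p q h := rectint f (x0 + l1 * p) (x0 + l1 * (p + h)) (y0 + l2 * q) (y0 + l2 * (q + h)).
pose Q n (s s' : R * R) :=
  (s.1 <= s'.1 /\ s'.1 + 2^-1 ^+ n.+1 <= s.1 + 2^-1 ^+ n) /\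
  (s.2 <= s'.2 /\ s'.2 + 2^-1 ^+ n.+1 <= s.2 + 2^-1 ^+ n).
pose P n (s : R * R) := [/\ 0 <= s.1, s.1 + 2^-1 ^+ n <= 1, 0 <= s.2, s.2 + 2^-1 ^+ n <= 1
   & c * 4^-1 ^+ n <= nm (J s.1 s.2 (2^-1 ^+ n))].
have [|n [p q] [p0 p1 q0 q1 cJ]|s [s0 Hs]] := @dependent_seq (R * R)%type P Q (0, 0).
- rewrite /P /= !expr0 mulr1; split; rewrite ?lexx ?add0r//.
  rewrite /J ?add0r ?mulr0 ?addr0 ?mulr1 /l1 /l2.
  have -> : x0 + (x1 - x0) = x1 by ring.
  by have -> : y0 + (y1 - y0) = y1 by ring.
- have h0 : 0 <= (2^-1 : R) ^+ n by rewrite exprn_ge0.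
  have hS : (2^-1 : R) ^+ n = 2^-1 ^+ n.+1 + 2^-1 ^+ n.+1 by rewrite exprS; lra.
  set h := 2^-1 ^+ n in p1 q1 h0 cJ hS *; set k := 2^-1 ^+ n.+1 in hS *.
  rewrite /= in p0 p1 q0 q1.
  have {}cJ : c * 4^-1 ^+ n <= nm (J p q h) by exact: cJ.
  have JE : J p q h = (J p q k + J (p + k) q k) + (J p (q + k) k + J (p + k) (q + k) k).
    rewrite /J hS !addrA.
    rewrite (rectint_splity _ (y0 + l2 * (q + k))).
    by rewrite !(rectint_splitx _ (x0 + l1 * (p + k)) (x0 + l1 * p) (x0 + l1 * (p + k + k))) !addrA.
  have k0 : 0 <= k by rewrite /k exprn_ge0.
  suff [[u v] [u01 v01] uv] : exists2 d : R * R, (d.1 = 0 \/ d.1 = k) /\ (d.2 = 0 \/ d.2 = k) &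
      c * 4^-1 ^+ n.+1 <= nm (J (p + d.1) (q + d.2) k).
    exists (p + u, q + v); rewrite /P /Q /= -/h -/k; rewrite /= in u01 v01.
      by move: uv; case: u01 => ->; case: v01 => -> uv; split=> //; lra.
    by case: u01 => ->; case: v01 => ->; lra.
  have c4 : c * 4^-1 ^+ n = 4 * (c * 4^-1 ^+ n.+1) by rewrite [_ ^+ n.+1]exprS; field.
  set m := c * 4^-1 ^+ n.+1 in c4 *; rewrite c4 JE in cJ.
  have := le_normcD (J p q k + J (p + k) q k) (J p (q + k) k + J (p + k) (q + k) k).
  have := le_normcD (J p q k) (J (p + k) q k).
  have := le_normcD (J p (q + k) k) (J (p + k) (q + k) k).
  move=> a1 a2 a3.
  case: (lerP m (nm (J p q k))) => b1; first by exists (0, 0); rewrite ?addr0//; split; left.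
  case: (lerP m (nm (J (p + k) q k))) => b2; first by exists (k, 0); rewrite ?addr0//; split; [right|left].
  case: (lerP m (nm (J p (q + k) k))) => b3; first by exists (0, k); rewrite ?addr0//; split; [left|right].
  exists (k, k); first by split; right.
  by rewrite /=; lra.
have [p pP] := @nested_dyadic (fun n => (s n).1) (fun n => (Hs n).2.1).
have [q qP] := @nested_dyadic (fun n => (s n).2) (fun n => (Hs n).2.2).
have p01 : 0 <= p <= 1 by have := pP 0%N; rewrite s0 /= expr0 add0r.
have q01 : 0 <= q <= 1 by have := qP 0%N; rewrite s0 /= expr0 add0r.
pose xx := x0 + l1 * p; pose yy := y0 + l2 * q.
have /derivableP := df xx yy (in_range_mix _ _ p01) (in_range_mix _ _ q01).
set l := 'D_1 f _ => /derivable_affine_bound H.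
pose La := `|l1| + `|l2|.
have La0 : 0 <= La by rewrite addr_ge0.
(* Chosen so that [4 * e * La ^+ 2 < c], also when [La = 0]. *)
pose e := c / (8 * (La ^+ 2 + 1)).
have e0 : 0 < e by rewrite divr_gt0// mulr_gt0// ltr_wpDl// sqr_ge0.
have [d d0 dH] := H e e0.
have [n] : exists n, (2^-1 : R) ^+ n < d / (La + 1) by apply: dyadic_lt; rewrite divr_gt0// ltr_wpDl.
have h0 : 0 <= (2^-1 : R) ^+ n by rewrite exprn_ge0.
have [[_ _ _ _ cJ] _] := Hs n.
have e4 : (4^-1 : R) ^+ n = (2^-1 ^+ n) ^+ 2 by rewrite -exprM mulnC exprM; congr (_ ^+ n); lra.
rewrite e4 in cJ; have := pP n; have := qP n.
set h := 2^-1 ^+ n in h0 cJ *; case: (s n) cJ => pn qn cJ qh ph.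
have {}cJ : c * h ^+ 2 <= nm (J pn qn h) by exact: cJ.
rewrite /= in qh ph.
rewrite ltr_pdivlMr ?ltr_wpDl// => hd.
(* Minus the affine approximation of [f] at the limit point: adding [g] leaves the integral
   unchanged and the integrand small. *)
pose g z := (l * (xx +i* yy) - f (xx +i* yy)) + (- l) * z.
have cg : continuous g by exact: continuous_affine.
have Jg : J pn qn h = rectint (fun z => f z + g z) (x0 + l1 * pn) (x0 + l1 * (pn + h)) (y0 + l2 * qn) (y0 + l2 * (qn + h)).
  rewrite rectintD; [|exact: edge_continuousT|exact: edge_continuousT].
  by rewrite rectint_affine addr0.
have : nm (J pn qn h) <= 4 * (e * (La * h)) * (`|x0 + l1 * (pn + h) - (x0 + l1 * pn)| + `|y0 + l2 * (qn + h) - (y0 + l2 * qn)|).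
  rewrite Jg; apply: rectint_norm_le.
    by apply: edge_continuousT => z; apply: continuous_fD; [exact: cf|exact: cg].
  move=> x y /(in_range_dist h0 ph) xr /(in_range_dist h0 qh) yr _.
  have nd : nm (x +i* y - xx +i* yy) <= La * h.
    apply: le_trans (normc_le_ReIm _) _; rewrite /= /La mulrDl.
    exact: lerD.
  have -> : f (x +i* y) + g (x +i* y) = f (x +i* y) - (f (xx +i* yy) + l * (x +i* y - xx +i* yy)).
    by rewrite /g; ring.
  apply: le_trans (dH _ _) _.
    by apply: le_lt_trans nd _; apply: le_lt_trans hd; nra.
  by rewrite ler_wpM2l// ltW.
have -> : x0 + l1 * (pn + h) - (x0 + l1 * pn) = l1 * h by ring.
have -> : y0 + l2 * (qn + h) - (y0 + l2 * qn) = l2 * h by ring.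
rewrite !normrM (ger0_norm h0) -mulrDl -/La.
move=> /(le_trans cJ).
have -> : 4 * (e * (La * h)) * (La * h) = 4 * e * La ^+ 2 * h ^+ 2 by ring.
have hp : 0 < h by rewrite /h exprn_gt0.
rewrite ler_pM2r ?exprn_gt0//.
have -> : c = e * (8 * (La ^+ 2 + 1)).
  by rewrite /e divfK// gt_eqF// mulr_gt0// ltr_wpDl// sqr_ge0.
have := sqr_ge0 La; nra.
Qed.

Lemma cintxx (G : R -> C) (a : R) : cint G a a = 0.
Proof. by rewrite /cint /rint !subrr. Qed.

Lemma rectint_degx f x y0 y1 : rectint f x x y0 y1 = 0.
Proof. by rewrite /rectint !cintxx !subrr mulr0 addr0. Qed.

Lemma rectint_degy f x0 x1 y : rectint f x0 x1 y y = 0.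
Proof. by rewrite /rectint !cintxx !subrr mulr0 addr0. Qed.

End goursat.

(** * Removable points *)

Section removable.
Variable R : realType.
Local Notation C := R[i].
Local Notation nm := (@Normc.normc R).
Local Notation Re := (@complex.Re R).
Local Notation Im := (@complex.Im R).
Implicit Types (f g : C -> C) (x y t : R) (z w : C).

Lemma in_rangeE (a b t : R) :
  in_range a b t = ((a <= t) || (b <= t)) && ((t <= a) || (t <= b)).
Proof. by rewrite /in_range ge_min le_max. Qed.

Lemma in_range_trans (a b c d t : R) :
  in_range a b c -> in_range a b d -> in_range c d t -> in_range a b t.
Proof.
rewrite !in_rangeE => /andP[/orP h1 /orP h2] /andP[/orP h3 /orP h4] /andP[/orP h5 /orP h6].
apply/andP; split.
  case: h5 => h5; [case: h1 => h1|case: h3 => h3]; apply/orP; by [left; lra|right; lra].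
case: h6 => h6; [case: h2 => h2|case: h4 => h4]; apply/orP; by [left; lra|right; lra].
Qed.

Lemma rectint_swapx f x0 x1 y0 y1 : rectint f x0 x1 y0 y1 = - rectint f x1 x0 y0 y1.
Proof.
apply/eqP; rewrite -subr_eq0 opprK -rectint_splitx rectint_degx; exact/eqP.
Qed.

Lemma rectint_swapy f x0 x1 y0 y1 : rectint f x0 x1 y0 y1 = - rectint f x0 x1 y1 y0.
Proof.
apply/eqP; rewrite -subr_eq0 opprK -rectint_splity rectint_degy; exact/eqP.
Qed.

Lemma linear_bound_eq0 (u K d : R) : 0 <= u -> 0 < d ->
  (forall s, 0 < s < d -> u <= K * s) -> u = 0.
Proof.
move=> u0 d0 H; apply/eqP; rewrite eq_le u0 andbT leNgt; apply/negP => up.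
have K0 : 0 < `|K| + 1 by rewrite ltr_wpDl.
pose s := Num.min (d / 2) (u / (2 * (`|K| + 1))).
have s0 : 0 < s by rewrite lt_min !divr_gt0// mulr_gt0.
have sd : s < d by rewrite gt_min; apply/orP; left; lra.
have := H s; rewrite s0 sd => /(_ isT).
have : s <= u / (2 * (`|K| + 1)) by rewrite ge_min lexx orbT.
rewrite ler_pdivlMr ?mulr_gt0//.
have := ler_norm K; nra.
Qed.

(** Cutting at relative distance [s] from the corner leaves two rectangles that avoid the point and
    a small one containing it. Since [f] is bounded near the point, the integral over the small one
    is at most a constant times [s]. *)
Lemma corner_rectint0 f px py x1 y1 : continuous f ->
  (forall a b c d, in_range px x1 a -> in_range px x1 b ->
     in_range py y1 c -> in_range py y1 d ->
     ~ (in_range a b px /\ in_range c d py) -> rectint f a b c d = 0) ->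
  rectint f px x1 py y1 = 0.
Proof.
move=> cf H.
have [->|x1p] := eqVneq x1 px; first exact: rectint_degx.
have [->|y1p] := eqVneq y1 py; first exact: rectint_degy.
apply/eqP; rewrite -normc_eq0; apply/eqP.
have [d d0 dM] := (continuous_normcP f (px +i* py)).1 (cf _) 1 ltr01.
pose La := `|x1 - px| + `|y1 - py|.
have La0 : 0 <= La by rewrite addr_ge0.
pose M := nm (f (px +i* py)) + 1.
apply: (@linear_bound_eq0 _ (4 * M * La) (Num.min 1 (d / (La + 1)))).
- exact: normc_ge0.
- by rewrite lt_min ltr01 divr_gt0// ltr_wpDl.
move=> s /andP[s0]; rewrite lt_min ltr_pdivlMr ?ltr_wpDl// => /andP[s1 sd].
have s01 : 0 <= s <= 1 by rewrite (ltW s0) (ltW s1).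
pose c := px + (x1 - px) * s; pose e := py + (y1 - py) * s.
have cr : in_range px x1 c by exact: in_range_mix.
have er : in_range py y1 e by exact: in_range_mix.
have outc : ~ in_range c x1 px.
  rewrite in_rangeE /c => /andP[/orP h1 /orP h2].
  case: (ltgtP x1 px) x1p => // hx _.
    have : 0 < (px - x1) * s by rewrite mulr_gt0// subr_gt0.
    have : 0 < (px - x1) * (1 - s) by rewrite mulr_gt0// subr_gt0.
    by case: h1; case: h2; lra.
  have : 0 < (x1 - px) * s by rewrite mulr_gt0// subr_gt0.
  have : 0 < (x1 - px) * (1 - s) by rewrite mulr_gt0// subr_gt0.
  by case: h1; case: h2; lra.
have oute : ~ in_range e y1 py.
  rewrite in_rangeE /e => /andP[/orP h1 /orP h2].
  case: (ltgtP y1 py) y1p => // hx _.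
    have : 0 < (py - y1) * s by rewrite mulr_gt0// subr_gt0.
    have : 0 < (py - y1) * (1 - s) by rewrite mulr_gt0// subr_gt0.
    by case: h1; case: h2; lra.
  have : 0 < (y1 - py) * s by rewrite mulr_gt0// subr_gt0.
  have : 0 < (y1 - py) * (1 - s) by rewrite mulr_gt0// subr_gt0.
  by case: h1; case: h2; lra.
have -> : rectint f px x1 py y1 = rectint f px c py e.
  rewrite (rectint_splitx _ c) (rectint_splity _ e px c).
  rewrite (H c x1 py y1)//; try exact: in_rangel; try exact: in_ranger; last by case.
  rewrite (H px c e y1)//; try exact: in_rangel; try exact: in_ranger; last by case.
  by rewrite !addr0.
have -> : 4 * M * La * s = 4 * M * (`|c - px| + `|e - py|).
  have -> : c - px = (x1 - px) * s by rewrite /c; ring.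
  have -> : e - py = (y1 - py) * s by rewrite /e; ring.
  by rewrite !normrM (ger0_norm (ltW s0)) /La; ring.
apply: rectint_norm_le; first exact: edge_continuousT.
move=> x y xr yr _.
have xr' : `|x - px| <= `|x1 - px| * s.
  have := @in_range_dist R px (x1 - px) 0 s 0 x (ltW s0).
  rewrite mulr0 !addr0 !add0r lexx (ltW s0) => /(_ isT); exact.
have yr' : `|y - py| <= `|y1 - py| * s.
  have := @in_range_dist R py (y1 - py) 0 s 0 y (ltW s0).
  rewrite mulr0 !addr0 !add0r lexx (ltW s0) => /(_ isT); exact.
have nd : nm (x +i* y - px +i* py) < d.
  apply: le_lt_trans (normc_le_ReIm _) _ => /=.
  apply: le_lt_trans (lerD xr' yr') _; rewrite -mulrDl -/La.
  by apply: le_lt_trans sd; nra.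
have := dM _ nd => h.
have -> : f (x +i* y) = (f (x +i* y) - f (px +i* py)) + f (px +i* py) by rewrite subrK.
by apply: le_trans (le_normcD _ _) _; rewrite /M; lra.
Qed.

(** The point splits the rectangle into four having it as a corner; signed rectangles let the corner
    case cover all of them. The hypothesis is about integrals over sub-rectangles, not derivatives,
    so that the lemma can be applied again for a second point. *)
Lemma removable_rectint f px py x0 x1 y0 y1 : continuous f ->
  (forall a b c d, in_range x0 x1 a -> in_range x0 x1 b ->
     in_range y0 y1 c -> in_range y0 y1 d ->
     ~ (in_range a b px /\ in_range c d py) -> rectint f a b c d = 0) ->
  rectint f x0 x1 y0 y1 = 0.
Proof.
move=> cf H.
have [[xr yr]|np] := pselect (in_range x0 x1 px /\ in_range y0 y1 py); last first.
  by apply: H; rewrite ?in_rangel ?in_ranger.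
have K x y : in_range x0 x1 x -> in_range y0 y1 y -> rectint f px x py y = 0.
  move=> hx hy; apply: corner_rectint0 => //.
  move=> a b c d ha hb hc hd; apply: H.
  - exact: in_range_trans xr hx ha.
  - exact: in_range_trans xr hx hb.
  - exact: in_range_trans yr hy hc.
  - exact: in_range_trans yr hy hd.
rewrite (rectint_splitx _ px) !(rectint_splity _ py _ _ y0 y1).
rewrite !(rectint_swapy _ _ _ y0) !(rectint_swapx _ x0).
by rewrite !K ?in_rangel ?in_ranger// !oppr0 !addr0.
Qed.

(** Two exceptional points are what Cauchy's formula requires: the possible singularity 0 and the
    base point of the difference quotient. *)
Lemma goursat_except2 f p q x0 x1 y0 y1 : continuous f ->
  (forall x y, in_range x0 x1 x -> in_range y0 y1 y ->
     x +i* y <> p -> x +i* y <> q -> derivable f (x +i* y) 1) ->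
  rectint f x0 x1 y0 y1 = 0.
Proof.
case: p q => [px py] [qx qy] cf df.
apply: (@removable_rectint _ px py) => // a b c d ha hb hc hd np.
apply: (@removable_rectint _ qx qy) => // a' b' c' d' ha' hb' hc' hd' nq.
apply: goursat => // x y xr yr; apply: df.
- apply: in_range_trans ha hb _; exact: in_range_trans ha' hb' xr.
- apply: in_range_trans hc hd _; exact: in_range_trans hc' hd' yr.
- move=> [xE yE]; apply: np; rewrite -xE -yE; split.
    exact: in_range_trans ha' hb' xr.
  exact: in_range_trans hc' hd' yr.
- by move=> [xE yE]; apply: nq; rewrite -xE -yE.
Qed.

End removable.

(** * Cauchy's formula on a square *)

Section compact_square.
Variable R : realType.
Local Notation C := R[i].
Local Notation nm := (@Normc.normc R).
Local Notation Re := (@complex.Re R).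
Local Notation Im := (@complex.Im R).

Definition csquare (r : R) : set C := [set z | `|Re z| <= r /\ `|Im z| <= r].

Lemma compact_csquare r : compact (csquare r).
Proof.
have -> : csquare r = (fun p : R * R => p.1 +i* p.2) @` (`[- r, r] `*` `[- r, r]).
  apply/seteqP; split => [[x y] /= [h1 h2]|z [[x y] /= []]].
    exists (x, y) => //=; by rewrite !in_itv /= -!ler_norml.
  by rewrite !in_itv /= -!ler_norml => h1 h2 <-.
apply: continuous_compact; last by apply: compact_setX; exact: segment_compact.
apply: continuous_subspaceT => p A /nbhs_normcP[d d0 dA].
exists ([set x | `|x - p.1| < d / 2], [set x | `|x - p.2| < d / 2]) => /=.
  by split; apply/nbhs_ballP; exists (d / 2); rewrite /= ?divr_gt0// => x;
    rewrite -ball_normE /= distrC.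
move=> [x y] /= [h1 h2]; apply: dA; apply: le_lt_trans (normc_le_ReIm _) _ => /=.
lra.
Qed.

Lemma csquare_bounded r (f : C -> C) : continuous f ->
  exists2 M, 0 <= M & forall z, csquare r z -> nm (f z) <= M.
Proof.
move=> cf; have cnf : continuous (fun z => nm (f z)).
  move=> z A /nbhs_ballP[e /= e0 eA]; have := (continuous_normcP f z).1 (cf z) e e0.
  move=> [d d0 dH]; apply/nbhs_normcP; exists d => // w /dH h; apply: eA.
  rewrite -ball_normE /= (le_lt_trans _ h)//.
  have h1 := le_normcD (f w - f z) (f z); have h2 := le_normcD (f z - f w) (f w).
  rewrite !subrK in h1 h2; rewrite normcB in h2.
  by rewrite ler_norml; lra.
have : compact ((fun z => nm (f z)) @` csquare r).
  by apply: continuous_compact; [exact: continuous_subspaceT|exact: compact_csquare].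
move=> /compact_bounded[M [_ /(_ (M + 1))]]; rewrite ltrDl ltr01 => /(_ isT) H.
exists `|M + 1| => // z zr; apply: le_trans (ler_norm _).
by apply: le_trans (H _ _); [exact: ler_norm|exists z].
Qed.

End compact_square.

Section cauchy.
Variable R : realType.
Local Notation C := R[i].
Local Notation nm := (@Normc.normc R).
Local Notation Re := (@complex.Re R).
Local Notation Im := (@complex.Im R).
Implicit Types (f g F G : C -> C) (z w a b : C).

Lemma near_eq_continuous f g z : (\forall w \near z, g w = f w) ->
  {for z, continuous g} -> {for z, continuous f}.
Proof.
move=> fg cg A; rewrite /= -(nbhs_singleton fg) => /cg gA.
by apply: filterS2 fg gA => w /= <-.
Qed.

Lemma near_neq z a : z != a -> \forall w \near z, w != a.
Proof.
move=> za; apply/nbhs_normcP; exists (nm (z - a)); first by rewrite normc_gt0 subr_eq0.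
by move=> w; rewrite (normcB w); apply: contraTneq => ->; rewrite ltxx.
Qed.

Lemma slope_near f a l z : z != a ->
  \forall w \near z, (f w + (- f a)) * (w - a)^-1 = slope f a l w.
Proof. by move=> /near_neq; apply: filterS => w wa; rewrite /slope (negPf wa). Qed.

Lemma slope_continuous f a l : continuous f -> is_derive a (1 : C) f l -> continuous (slope f a l).
Proof.
move=> cf /derivable_slopeP df z; have [->//|za] := eqVneq z a.
apply: near_eq_continuous (slope_near f l za) _.
apply: continuous_fM; first by apply: continuous_fD; [exact: cf|exact: cst_continuous].
apply: (@continuous_fV _ (fun w => w - a)); first by rewrite subr_eq0.
exact: continuous_subC.
Qed.

Lemma slope_derivable f a l z : z != a -> derivable f z 1 -> derivable (slope f a l) z 1.
Proof.
move=> za /derivableP df; apply: near_eq_derivable (slope_near f l za) _.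
have h1 : is_derive z (1 : C) (fun w => f w + (- f a)) ('D_1 f z + 0).
  by apply: is_derive_fD.
have h2 : is_derive z (1 : C) (fun w => (w - a)^-1) (- 1 / (z - a) ^+ 2).
  apply: (@is_derive_fV _ (fun w => w - a)); first by rewrite subr_eq0.
  exact: is_derive_fshift.
by have [] := is_derive_fM h1 h2.
Qed.

Variable r : R.
Hypothesis r0 : 0 < r.

(** [line] is made of the full lines through the four sides, where continuity is required; [bd] is
    the boundary of the square, where bounds are required. *)
Let line z := `|Re z| = r \/ `|Im z| = r.
Let bd z := csquare r z /\ line z.
Let lcont F := forall z, line z -> {for z, continuous F}.
Let Sq F := rectint F (- r) r (- r) r.

Let norm_Nr : `|- r| = r. Proof. by rewrite normrN ger0_norm// ltW. Qed.
Let norm_r : `|r| = r. Proof. by rewrite ger0_norm// ltW. Qed.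

Lemma lcont_edge F : lcont F -> edge_continuous F (- r) r (- r) r.
Proof.
by move=> cF; split; (apply: ccontinuous_hseg || apply: ccontinuous_vseg) => t; apply: cF;
  [right|right|left|left].
Qed.

Lemma SqD F G : lcont F -> lcont G -> Sq (fun z => F z + G z) = Sq F + Sq G.
Proof. by move=> /lcont_edge h1 /lcont_edge h2; exact: rectintD. Qed.

Lemma SqZ k F : lcont F -> Sq (fun z => k * F z) = k * Sq F.
Proof. by move=> /lcont_edge h1; exact: rectintZ. Qed.

Lemma eq_Sq F G : (forall z, line z -> F z = G z) -> Sq F = Sq G.
Proof.
move=> FG; rewrite /Sq /rectint.
have hE y : `|y| = r -> hseg F y = hseg G y by move=> yr; apply/funext => t; apply: FG; right.
have vE x : `|x| = r -> vseg F x = vseg G x by move=> yr; apply/funext => t; apply: FG; left.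
by rewrite !hE// !vE.
Qed.

Lemma Sq_norm_le F M : lcont F -> (forall z, bd z -> nm (F z) <= M) -> nm (Sq F) <= 16 * M * r.
Proof.
move=> /lcont_edge cF FM.
have -> : 16 * M * r = 4 * M * (`|r - - r| + `|r - - r|).
  by rewrite ger0_norm; [ring|move: r0; lra].
apply: rectint_norm_le => // x y; rewrite !in_range_sym// => xr yr xy; apply: FM; split => //.
by case/or4P: xy => /eqP ->; [left|left|right|right].
Qed.

Lemma line_dist a z : nm a <= r / 2 -> line z -> r / 2 <= nm (z - a).
Proof.
move=> ar [] zr.
  apply: le_trans (ler_normc_Re _); rewrite ReB.
  have := le_trans (ler_normc_Re a) ar.
  by have := lerB_dist (Re z) (Re a); rewrite zr; lra.
apply: le_trans (ler_normc_Im _); rewrite ImB.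
have := le_trans (ler_normc_Im a) ar.
by have := lerB_dist (Im z) (Im a); rewrite zr; lra.
Qed.

Lemma line_neq a z : nm a <= r / 2 -> line z -> z != a.
Proof.
move=> ar zr; rewrite -subr_eq0 -normc_gt0; apply: lt_le_trans (line_dist ar zr).
by rewrite divr_gt0.
Qed.

Definition ckernel a z : C := (z - a)^-1.

Lemma ckernel_lcont a : nm a <= r / 2 -> lcont (ckernel a).
Proof.
move=> ar z zl; apply: (@continuous_fV _ (fun w => w - a)); last exact: continuous_subC.
by rewrite subr_eq0; exact: line_neq zl.
Qed.

Lemma ckernel_norm a z : nm a <= r / 2 -> line z -> nm (ckernel a z) <= 2 / r.
Proof.
move=> ar zl; rewrite /ckernel Normc.normcV.
have h := line_dist ar zl; have r2 : 0 < r / 2 by rewrite divr_gt0.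
have -> : 2 / r = (r / 2)^-1 by rewrite invf_div.
by rewrite lef_pV2 ?posrE// (lt_le_trans r2).
Qed.

Lemma lcontM F G : lcont F -> lcont G -> lcont (fun z => F z * G z).
Proof. by move=> cF cG z zl; apply: continuous_fM; [exact: cF|exact: cG]. Qed.

(** The Cauchy transform over the boundary of the square, without the factor 1/(2 pi i); [ctrans']
    has the kernel differentiated in [a]. Cauchy's formula is later used as a quotient by
    [ctrans (fun=> 1)], for which a lower bound takes the place of the value 2 pi i. *)
Definition ctrans G a := Sq (fun z => G z * ckernel a z).
Definition ctrans' G a := Sq (fun z => G z * (ckernel a z * ckernel a z)).

Lemma ctrans_norm G M a : continuous G -> (forall z, bd z -> nm (G z) <= M) ->
  nm a <= r / 2 -> nm (ctrans G a) <= 32 * M.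
Proof.
move=> cG GM ar; have -> : 32 * M = 16 * (M * (2 / r)) * r by field; rewrite gt_eqF.
apply: Sq_norm_le; first exact: (lcontM (fun z _ => cG z) (ckernel_lcont ar)).
move=> z zb; rewrite Normc.normcM; apply: ler_pM; rewrite ?normc_ge0//; first exact: GM.
by apply: ckernel_norm => //; case: zb.
Qed.

Lemma ctrans'_norm G M a : continuous G -> (forall z, bd z -> nm (G z) <= M) ->
  nm a <= r / 2 -> nm (ctrans' G a) <= 64 / r * M.
Proof.
move=> cG GM ar; have -> : 64 / r * M = 16 * (M * (2 / r * (2 / r))) * r by field; rewrite gt_eqF.
have ck := ckernel_lcont ar.
apply: Sq_norm_le; first exact: (lcontM (fun z _ => cG z) (lcontM ck ck)).
move=> z zb; rewrite !Normc.normcM; apply: ler_pM; rewrite ?mulr_ge0 ?normc_ge0//; first exact: GM.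
by apply: ler_pM; rewrite ?normc_ge0//; apply: ckernel_norm => //; case: zb.
Qed.

(** Differentiation under the integral sign. The error of the difference quotient is exactly the
    integral of [(b - a) G(z) / ((z - a)^2 (z - b))], where each kernel factor is at most
    [2 / r]. *)
Lemma is_derive_ctrans G M a : continuous G -> (forall z, bd z -> nm (G z) <= M) -> 0 <= M ->
  nm a < r / 2 -> is_derive a (1 : C) (ctrans G) (ctrans' G a).
Proof.
move=> cG GM M0 ar; apply/derivable_slopeP/continuous_normcP => e e0.
(* [128 / r ^+ 2] is [16 * r * (2 / r) ^+ 3]: the constant of [Sq_norm_le] times three kernel
   bounds. The added 1 makes [K] positive even if [M = 0]. *)
pose K := 128 / r ^+ 2 * M + 1.
have K0 : 0 < K by rewrite /K ltr_wpDl// mulr_ge0// divr_ge0// exprn_ge0// ltW.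
exists (Num.min (r / 2 - nm a) (e / K)).
  by rewrite lt_min subr_gt0 ar divr_gt0.
move=> b; rewrite lt_min ltr_pdivlMr// => /andP[b1 b2].
rewrite /slope eqxx; case: eqVneq => [_|ba]; first by rewrite subrr Normc.normc0.
have ar' := ltW ar.
have br : nm b <= r / 2.
  by have := le_normcD (b - a) a; rewrite subrK; lra.
have ba0 : b - a != 0 by rewrite subr_eq0.
have ca := ckernel_lcont ar'; have cb := ckernel_lcont br.
have cGl : lcont G by move=> z _; exact: cG.
have -> : (ctrans G b - ctrans G a) / (b - a) - ctrans' G a =
  Sq (fun z => (b - a) * (G z * (ckernel a z * ckernel a z * ckernel b z))).
  have -> : Sq (fun z => (b - a) * (G z * (ckernel a z * ckernel a z * ckernel b z))) =
    Sq (fun z => (b - a)^-1 * (G z * ckernel b z) + ((- (b - a)^-1) * (G z * ckernel a z)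
        + (-1) * (G z * (ckernel a z * ckernel a z)))).
    apply: eq_Sq => z zl; rewrite /ckernel.
    have h1 : z - a != 0 by rewrite subr_eq0; exact: line_neq ar' zl.
    have h2 : z - b != 0 by rewrite subr_eq0; exact: line_neq br zl.
    by field; rewrite h1 h2 ba0.
  have c1 : lcont (fun z => G z * ckernel b z) := lcontM cGl cb.
  have c2 : lcont (fun z => G z * ckernel a z) := lcontM cGl ca.
  have c3 : lcont (fun z => G z * (ckernel a z * ckernel a z)) := lcontM cGl (lcontM ca ca).
  have cst k : lcont (fun=> k : C) by move=> z _; exact: cst_continuous.
  have d1 := lcontM (cst (b - a)^-1) c1.
  have d2 := lcontM (cst (- (b - a)^-1)) c2.
  have d3 := lcontM (cst (-1)) c3.
  rewrite (SqD d1); last by move=> z zl; exact: (continuous_fD (d2 z zl) (d3 z zl)).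
  rewrite (SqD d2 d3) (SqZ _ c1) (SqZ _ c2) (SqZ _ c3) /ctrans /ctrans'; ring.
apply: (@le_lt_trans _ _ (K * nm (b - a))); last by rewrite mulrC.
have r20 : 0 <= 2 / r by rewrite divr_ge0// ltW.
apply: (@le_trans _ _ (16 * (nm (b - a) * (M * (2 / r * (2 / r) * (2 / r)))) * r)).
  apply: Sq_norm_le.
    move=> z zl; apply: continuous_fM; first exact: cst_continuous.
    exact: (lcontM cGl (lcontM (lcontM ca ca) cb)).
  move=> z zb; rewrite !Normc.normcM; apply: ler_wpM2l; first exact: normc_ge0.
  have zl : line z by case: zb.
  apply: ler_pM; rewrite ?mulr_ge0 ?normc_ge0//; first exact: GM.
  apply: ler_pM; rewrite ?mulr_ge0 ?normc_ge0//; last exact: ckernel_norm.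
  by apply: ler_pM; rewrite ?normc_ge0//; exact: ckernel_norm.
have -> : 16 * (nm (b - a) * (M * (2 / r * (2 / r) * (2 / r)))) * r = 128 / r ^+ 2 * M * nm (b - a).
  by field; rewrite gt_eqF.
by rewrite ler_wpM2r ?normc_ge0// /K lerDl.
Qed.

(** On each side the integrand contributes to the imaginary part the distance from [a] to the line
    of the side divided by [|z - a|^2]. This is at least [(r / 2) / (2 (3 r / 2)^2) = 1 / (9 r)];
    four sides of length [2 r] give 8/9. *)
Lemma winding_Im a : nm a <= r / 2 -> 8 / 9 <= Im (ctrans (fun=> 1) a).
Proof.
move=> ar; have hx := le_trans (ler_normc_Re a) ar; have hy := le_trans (ler_normc_Im a) ar.
have ck := ckernel_lcont ar; have := lcont_edge ck => -[k1 k2 k3 k4].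
case: a ar ck k1 k2 k3 k4 hx hy => [a1 a2] ar ck k1 k2 k3 k4 hx hy.
move: hx hy; rewrite [complex.Re _]/= [complex.Im (a1 +i* a2)]/= !ler_norml.
move=> /andP[a3 a4] /andP[a5 a6].
have rr : - r <= r by move: r0; lra.
have key (p q s : R) : `|p| <= 3 / 2 * r -> `|q| <= 3 / 2 * r -> s = `|p| \/ s = `|q| ->
    r / 2 <= s -> (9 * r)^-1 <= s / (p ^+ 2 + q ^+ 2).
  move=> pb qb spq rs.
  have h1 : p ^+ 2 <= (3 / 2 * r) ^+ 2.
    by rewrite -[p ^+ 2]real_normK ?num_real// lerXn2r ?nnegrE// mulr_ge0// ltW.
  have h2 : q ^+ 2 <= (3 / 2 * r) ^+ 2.
    by rewrite -[q ^+ 2]real_normK ?num_real// lerXn2r ?nnegrE// mulr_ge0// ltW.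
  have s0 : 0 < s by apply: lt_le_trans rs; rewrite divr_gt0.
  have h0 : 0 < p ^+ 2 + q ^+ 2.
    case: spq => spq.
      by rewrite ltr_pwDl ?sqr_ge0// lt_def sqr_ge0 andbT sqrf_eq0 -normr_gt0 -spq.
    by rewrite ltr_wpDl ?sqr_ge0// lt_def sqr_ge0 andbT sqrf_eq0 -normr_gt0 -spq.
  rewrite ler_pdivlMr// mulrC ler_pdivrMr ?mulr_gt0//.
  by move: r0 rs h1 h2; nra.
have -> : ctrans (fun=> 1) (a1 +i* a2) = Sq (ckernel (a1 +i* a2)).
  by apply: eq_Sq => z _; rewrite mul1r.
set k := ckernel _ in k1 k2 k3 k4 *.
have -> : Sq k = cint (hseg k (- r)) (- r) r + cint (fun t => (-1) * hseg k r t) (- r) r +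
  (cint (fun t => 'i%C * vseg k r t) (- r) r + cint (fun t => (- 'i%C) * vseg k (- r) t) (- r) r).
  by rewrite !cintZ// /Sq /rectint; ring.
have ImD (u v : C) : Im (u + v) = Im u + Im v by case: u v => ? ? [].
have e29 : 2 / 9 = (9 * r)^-1 * (r - - r) by field; rewrite gt_eqF.
have i1 : 2 / 9 <= Im (cint (hseg k (- r)) (- r) r).
  rewrite e29; apply: cint_Im_ge => // t /andP[t1 t2].
  have -> : Im (hseg k (- r) t) = (r + a2) / ((t - a1) ^+ 2 + (- r - a2) ^+ 2).
    by rewrite /hseg /k /ckernel /= -mulNr; congr (_ / _); ring.
  have n2 : `|- r - a2| = r + a2 by rewrite ler0_norm; move: r0; lra.
  apply: key; rewrite ?n2; [rewrite ler_norml| |by right|]; move: r0; lra.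
have i2 : 2 / 9 <= Im (cint (fun t => (-1) * hseg k r t) (- r) r).
  rewrite e29; apply: cint_Im_ge => // [|t /andP[t1 t2]]; first exact: ccontinuousZ.
  have -> : Im (-1 * hseg k r t) = (r - a2) / ((t - a1) ^+ 2 + (r - a2) ^+ 2).
    by rewrite mulN1r /hseg /k /ckernel /= opprK.
  have n2 : `|r - a2| = r - a2 by rewrite ger0_norm; move: r0; lra.
  apply: key; rewrite ?n2; [rewrite ler_norml| |by right|]; move: r0; lra.
have i3 : 2 / 9 <= Im (cint (fun t => 'i%C * vseg k r t) (- r) r).
  rewrite e29; apply: cint_Im_ge => // [|t /andP[t1 t2]]; first exact: ccontinuousZ.
  have -> : Im ('i%C * vseg k r t) = (r - a1) / ((r - a1) ^+ 2 + (t - a2) ^+ 2).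
    by rewrite /vseg /k /ckernel /= mul0r add0r mul1r.
  have n2 : `|r - a1| = r - a1 by rewrite ger0_norm; move: r0; lra.
  apply: key; rewrite ?n2; [|rewrite ler_norml|by left|]; move: r0; lra.
have i4 : 2 / 9 <= Im (cint (fun t => (- 'i%C) * vseg k (- r) t) (- r) r).
  rewrite e29; apply: cint_Im_ge => // [|t /andP[t1 t2]]; first exact: ccontinuousZ.
  have -> : Im (- 'i%C * vseg k (- r) t) = (r + a1) / ((- r - a1) ^+ 2 + (t - a2) ^+ 2).
    rewrite /vseg /k /ckernel /= oppr0 mul0r add0r mulN1r -mulNr; congr (_ / _); ring.
  have n2 : `|- r - a1| = r + a1 by rewrite ler0_norm; move: r0; lra.
  apply: key; rewrite ?n2; [|rewrite ler_norml|by left|]; move: r0; lra.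
rewrite !ImD; lra.
Qed.

Lemma winding_norm a : nm a <= r / 2 -> 8 / 9 <= nm (ctrans (fun=> 1) a).
Proof.
move=> /winding_Im h; apply: le_trans h _; apply: le_trans (ler_normc_Im _).
exact: ler_norm.
Qed.

End cauchy.

(** * Isolated singularities and zeros *)

Section isolated.
Variable R : realType.
Local Notation C := R[i].
Local Notation nm := (@Normc.normc R).
Local Notation Re := (@complex.Re R).
Local Notation Im := (@complex.Im R).
Implicit Types (f g F G : C -> C) (z w a b : C) (r : R).

(** Continuity on the whole plane makes the integrals over full lines meaningful; [cclamp] will
    supply it for functions given locally. *)
Definition holomorphic_off0 r f :=
  continuous f /\ forall z, csquare r z -> z != 0 -> derivable f z 1.

Lemma normc_csquare r z : nm z <= r -> csquare r z.
Proof.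
by move=> zr; split; apply: le_trans zr; [exact: ler_normc_Re|exact: ler_normc_Im].
Qed.

(** Goursat's lemma applies to the difference quotient of [f] at [a], which is continuous, with 0
    and [a] as exceptional points. The case [a = 0] is excluded because [f] must already be
    differentiable at [a]. *)
Lemma cauchy_formula_off0 r f a : 0 < r -> holomorphic_off0 r f -> nm a <= r / 2 -> a != 0 ->
  ctrans r f a = f a * ctrans r (fun=> 1) a.
Proof.
move=> r0 [cf df] ar a0.
have /derivableP : derivable f a 1 by apply: df => //; apply: normc_csquare; lra.
set l := 'D_1 f a => dfa.
have cs := slope_continuous cf dfa.
have : rectint (slope f a l) (- r) r (- r) r = 0.
  apply: (@goursat_except2 _ _ 0 a) => // x y; rewrite !in_range_sym// => xr yr z0 za.
  by apply: slope_derivable; [exact/eqP|apply: df; [split|exact/eqP]].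
have ck := ckernel_lcont r0 ar.
have c1 := lcontM (fun z _ => cf z) ck.
have c2 := lcontM (fun z _ => @cst_continuous _ _ (1 : C) z) ck.
have c3 := lcontM (fun z _ => @cst_continuous _ _ (- f a) z) c2.
rewrite (@eq_Sq _ r r0 _ (fun z => f z * ckernel a z + (- f a) * (1 * ckernel a z))); last first.
  move=> z /(line_neq r0 ar) za; rewrite /slope (negPf za) /ckernel mul1r; ring.
rewrite (SqD r0 c1 c3) (SqZ r0 _ c2) mulNr => /eqP; rewrite subr_eq0 => /eqP.
by [].
Qed.

Lemma exists_real_lt (d : R) : 0 < d -> exists2 w : C, w != 0 & nm w < d.
Proof.
move=> d0; exists (d / 2)%:C.
  by rewrite -normc_gt0 normc_real normr_gt0 gt_eqF// divr_gt0.
by rewrite normc_real gtr0_norm ?divr_gt0//; lra.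
Qed.

Lemma continuous_eq0 f : {for 0, continuous f} ->
  (exists2 d : R, 0 < d & forall w, w != 0 -> nm w < d -> f w = 0) -> f 0 = 0.
Proof.
move=> /continuous_normcP cf [d d0 dH]; apply/eqP; rewrite -normc_eq0; apply/negPn/negP => h.
have [|e e0 eH] := cf (nm (f 0)); first by rewrite normc_gt0 -normc_eq0.
have [|w w0] := @exists_real_lt (Num.min d e); first by rewrite lt_min d0.
rewrite lt_min => /andP[wd we]; have := eH w; rewrite subr0 => /(_ we).
by rewrite dH// sub0r normcN ltxx.
Qed.

(** Both sides are continuous in [a], so the formula extends to [a = 0]. *)
Lemma cauchy_formula r f a : 0 < r -> holomorphic_off0 r f -> nm a < r / 2 ->
  ctrans r f a = f a * ctrans r (fun=> 1) a.
Proof.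
move=> r0 hf ar; have [a0|] := eqVneq a 0; last exact: cauchy_formula_off0 (ltW ar).
have [cf _] := hf; rewrite a0; rewrite a0 in ar.
have [M M0 fM] := csquare_bounded r cf.
have c1 : continuous (fun _ : C => 1 : C) by move=> z; exact: cst_continuous.
have fM' z : csquare r z /\ (`|Re z| = r \/ `|Im z| = r) -> nm (f z) <= M by case=> /fM.
have oM (z : C) : csquare r z /\ (`|Re z| = r \/ `|Im z| = r) -> nm (1 : C) <= 1.
  by rewrite Normc.normc1.
have d1 := is_derive_continuous (is_derive_ctrans r0 cf fM' M0 ar).
have d2 := is_derive_continuous (is_derive_ctrans r0 c1 oM ler01 ar).
apply/eqP; rewrite -subr_eq0; apply/eqP; rewrite -mulrN.
have c3 : {for 0, continuous (fun a => - ctrans r (fun=> 1) a)} by apply: continuousN.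
have := @continuous_eq0 _ (continuous_fD d1 (continuous_fM (cf 0) c3)).
apply; exists (r / 2); first by rewrite divr_gt0.
move=> w w0 wr; rewrite (cauchy_formula_off0 r0 hf (ltW wr) w0); ring.
Qed.

Lemma winding_neq0 r a : 0 < r -> nm a <= r / 2 -> ctrans r (fun=> 1) a != 0.
Proof.
by move=> r0 ar; rewrite -normc_gt0; apply: lt_le_trans (winding_norm r0 ar); lra.
Qed.

Lemma winding_inv r a : 0 < r -> nm a <= r / 2 -> nm (ctrans r (fun=> 1) a)^-1 <= 2.
Proof.
move=> r0 ar; rewrite Normc.normcV; have := winding_norm r0 ar => h.
by rewrite -[leRHS]invrK lef_pV2 ?posrE//; lra.
Qed.

(** The bound is asked only at modulus at least [r], which includes the boundary of the square;
    there a quotient by [z ^+ n] is controlled. The constant is 32 from the transform times 2 from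
    the inverse of the winding factor. *)
Lemma cauchy_estimate r f M a : 0 < r -> holomorphic_off0 r f ->
  (forall z, csquare r z -> r <= nm z -> nm (f z) <= M) -> nm a <= r / 4 -> nm (f a) <= 64 * M.
Proof.
move=> r0 hf fM ar; have ar2 : nm a < r / 2 by lra.
have -> : f a = ctrans r f a * (ctrans r (fun=> 1) a)^-1.
  by rewrite cauchy_formula// mulfK// winding_neq0// ltW.
rewrite Normc.normcM (_ : 64 * M = 32 * M * 2); last by ring.
apply: ler_pM; rewrite ?normc_ge0//; last exact: winding_inv (ltW ar2).
have [cf _] := hf; apply: ctrans_norm => //; last exact: ltW.
move=> z [zr zl]; apply: fM => //.
case: zl => <-; [exact: ler_normc_Re|exact: ler_normc_Im].
Qed.

(** Cauchy's formula writes [f] near [a] as a quotient of two differentiable transforms, at [a = 0]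
    as well: the singularity is removed. The uniform bound on the derivative is used in
    [derive_neq0_near]. *)
Lemma holomorphic_off0_derivable r f : 0 < r -> holomorphic_off0 r f ->
  exists L : R, forall a, nm a <= r / 4 -> exists2 l, is_derive a (1 : C) f l & nm l <= L.
Proof.
move=> r0 hf; have [cf _] := hf; have [M M0 fM] := csquare_bounded r cf.
have c1 : continuous (fun _ : C => 1 : C) by move=> z; exact: cst_continuous.
exists (32 * M * (64 / r * 1 * (2 * 2)) + 2 * (64 / r * M)) => a ar.
have ar2 : nm a < r / 2 by lra.
have fM' z : csquare r z /\ (`|Re z| = r \/ `|Im z| = r) -> nm (f z) <= M by case=> /fM.
have oM (z : C) : csquare r z /\ (`|Re z| = r \/ `|Im z| = r) -> nm (1 : C) <= 1.
  by rewrite Normc.normc1.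
have dT := is_derive_ctrans r0 cf fM' M0 ar2.
have dW := is_derive_ctrans r0 c1 oM ler01 ar2.
have W0 := winding_neq0 r0 (ltW ar2).
have dWi := is_derive_fV W0 dW.
have dF := is_derive_fM dT dWi.
exists (ctrans r f a * (- ctrans' r (fun=> 1) a / ctrans r (fun=> 1) a ^+ 2) +
        (ctrans r (fun=> 1) a)^-1 * ctrans' r f a).
  apply: near_eq_is_derive dF; apply/nbhs_normcP.
  exists (r / 2 - nm a); first by rewrite subr_gt0.
  move=> b ba; have br : nm b < r / 2 by have := le_normcD (b - a) a; rewrite subrK; lra.
  by rewrite cauchy_formula// mulfK// winding_neq0// ltW.
apply: le_trans (le_normcD _ _) _; apply: lerD; rewrite !Normc.normcM.
  apply: ler_pM; rewrite ?mulr_ge0 ?normc_ge0//; first exact: ctrans_norm (ltW ar2).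
  rewrite normcN; apply: ler_pM; rewrite ?normc_ge0//.
    exact: (ctrans'_norm r0 c1 oM (ltW ar2)).
  rewrite Normc.normcV expr2 Normc.normcM invfM -Normc.normcV.
  by apply: ler_pM; rewrite ?normc_ge0//; exact: winding_inv (ltW ar2).
apply: ler_pM; rewrite ?normc_ge0//; first exact: winding_inv (ltW ar2).
exact: ctrans'_norm (ltW ar2).
Qed.

(** The class is closed under taking the difference quotient at 0, so division by [z] can be
    iterated. *)
Lemma holomorphic_off0_slope r f : 0 < r -> holomorphic_off0 r f ->
  holomorphic_off0 r (slope f 0 ('D_1 f 0)).
Proof.
move=> r0 hf; have [L HL] := holomorphic_off0_derivable r0 hf.
have n0 : nm (0 : C) <= r / 4 by rewrite Normc.normc0; lra.
have [l [dl _] _] := HL 0 n0.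
have [cf df] := hf; split; first exact: slope_continuous cf (derivableP dl).
by move=> z zr z0; exact: slope_derivable z0 (df z zr z0).
Qed.

(** Otherwise [f] is divisible by [z ^+ n] for every [n]. The Cauchy estimate bounds the quotient by
    [64 M / r^n], hence [|f a| <= 64 M (|a| / r)^n], and [f] vanishes for [|a| <= r / 4]. *)
Lemma zero_order r f : 0 < r -> holomorphic_off0 r f -> f 0 = 0 ->
  (forall d : R, 0 < d -> exists2 z, nm z < d & f z != 0) ->
  exists m g, [/\ holomorphic_off0 r g, g 0 != 0 & forall z, f z = z ^+ m.+1 * g z].
Proof.
move=> r0 hf f0 nz; apply: contrapT => nex.
pose F := fix F n := if n is m.+1 then slope (F m) 0 ('D_1 (F m) 0) else f.
have HF n : [/\ holomorphic_off0 r (F n), F n 0 = 0 & forall z, f z = z ^+ n * F n z].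
  elim: n => [|n [h1 h2 h3]]; first by split => // z; rewrite expr0 mul1r.
  have h1' := holomorphic_off0_slope r0 h1.
  have h3' z : f z = z ^+ n.+1 * F n.+1 z.
    by rewrite h3 (slopeE (F n) 0 ('D_1 (F n) 0) z) h2 add0r subr0 mulrA -exprSr.
  split => //; apply/eqP/negPn/negP => h; apply: nex; exists n, (F n.+1); split => //.
have [cf _] := hf; have [M M0 fM] := csquare_bounded r cf.
have fa0 a : nm a <= r / 4 -> nm (f a) <= 0.
  move=> ar; apply/ler_addgt0Pr => e e0; rewrite add0r.
  have [n ne] : exists n, (2^-1 : R) ^+ n < e / (64 * M + 1).
    by apply: dyadic_lt; rewrite divr_gt0// ltr_wpDl// mulr_ge0.
  have [h1 _ h3] := HF n.
  have rn : 0 < r ^+ n by rewrite exprn_gt0.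
  have Fa : nm (F n a) <= 64 * (M / r ^+ n).
    apply: (@cauchy_estimate r) => // z zr rz.
    rewrite ler_pdivlMr//; apply: le_trans (fM z zr).
    rewrite h3 Normc.normcM normcX mulrC ler_wpM2r ?normc_ge0//.
    by rewrite lerXn2r ?nnegrE ?normc_ge0// ltW.
  rewrite h3 Normc.normcM normcX.
  have an : nm a ^+ n <= 2^-1 ^+ n * r ^+ n.
    by rewrite -exprMn lerXn2r ?nnegrE ?normc_ge0//; lra.
  apply: (@le_trans _ _ (2^-1 ^+ n * r ^+ n * (64 * (M / r ^+ n)))).
    by apply: ler_pM; rewrite ?exprn_ge0 ?normc_ge0.
  have -> : 2^-1 ^+ n * r ^+ n * (64 * (M / r ^+ n)) = 2^-1 ^+ n * (64 * M).
    rewrite [LHS](_ : _ = 2^-1 ^+ n * (64 * M) * (r ^+ n / r ^+ n)); last by ring.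
    by rewrite divff ?mulr1// gt_eqF.
  move: ne; rewrite ltr_pdivlMr ?ltr_wpDl ?mulr_ge0// => ne.
  have : (0 : R) <= 2^-1 ^+ n by rewrite exprn_ge0.
  nra.
have [|z zr /negP] := nz (r / 4); first by rewrite divr_gt0.
apply; rewrite -normc_eq0 eq_le normc_ge0 andbT; apply: fa0; exact: ltW.
Qed.

Lemma is_derive_fX (n : nat) z : is_derive z (1 : C) (fun w => w ^+ n) (n%:R * z ^+ n.-1).
Proof.
have := @is_deriveX _ _ (id : C -> C) n z 1 1 (is_derive_id _ _).
by rewrite /GRing.scale /= mulr1; apply: near_eq_is_derive; near=> w; rewrite fctE.
Unshelve. all: by end_near. Qed.

(** With [f = z^(m+1) g], the derivative is [z^m ((m+1) g + z g')]. Near 0 one has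
    [|g| > |g 0| / 2 > |z g'|], so the bracket does not vanish. *)
Lemma derive_neq0_near r f : 0 < r -> holomorphic_off0 r f -> f 0 = 0 ->
  (forall d : R, 0 < d -> exists2 z, nm z < d & f z != 0) ->
  exists2 d : R, 0 < d & forall z, z != 0 -> nm z < d -> exists2 l, is_derive z (1 : C) f l & l != 0.
Proof.
move=> r0 hf f0 nz; have [m [g [hg g0 fE]]] := zero_order r0 hf f0 nz.
have [L HL] := holomorphic_off0_derivable r0 hg.
have [cg _] := hg.
pose e := nm (g 0) / 2; have e0 : 0 < e by rewrite divr_gt0// normc_gt0.
have [d1 d10 H1] := (continuous_normcP g 0).1 (cg 0) e e0.
have L0 : 0 < `|L| + 1 by rewrite ltr_wpDl.
exists (Num.min (r / 4) (Num.min d1 (e / (`|L| + 1)))).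
  rewrite !lt_min d10 (divr_gt0 e0 L0) !andbT; lra.
move=> z z0; rewrite !lt_min => /andP[z1 /andP[z2]]; rewrite ltr_pdivlMr// => z3.
have [l dl lL] := HL z (ltW z1).
have dp := is_derive_fM (is_derive_fX m.+1 z) dl.
exists (z ^+ m.+1 * l + g z * (m.+1%:R * z ^+ m)).
  by have -> : f = (fun w => w ^+ m.+1 * g w) by apply/funext.
have -> : z ^+ m.+1 * l + g z * (m.+1%:R * z ^+ m) = z ^+ m * (m.+1%:R * g z + z * l).
  by rewrite exprS; ring.
rewrite mulf_neq0 ?expf_neq0// addrC -normc_gt0.
have h1 := H1 z; rewrite subr0 in h1; have {h1} := h1 z2 => h1.
have h2 := le_normcD (g 0 - g z) (g z); rewrite subrK normcB in h2.
have h3 : nm (z * l) < e.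
  rewrite Normc.normcM; apply: le_lt_trans z3; apply: ler_wpM2l; first exact: normc_ge0.
  by apply: le_trans lL _; have := ler_norm L; lra.
have h4 : nm (g z) <= nm (m.+1%:R * g z).
  rewrite Normc.normcM ler_peMl ?normc_ge0//.
  have -> : (m.+1%:R : C) = (m.+1%:R : R)%:C by rewrite rmorph_nat.
  by rewrite normc_real normr_nat ler1n.
have h5 := le_normcD (z * l + m.+1%:R * g z) (- (z * l)).
rewrite normcN (_ : z * l + m.+1%:R * g z - z * l = m.+1%:R * g z) in h5; last by ring.
have : nm (g 0) = e + e by rewrite /e; lra.
lra.
Qed.

End isolated.

(** * Holomorphy of the inverse *)

Section inverse.
Variable R : realType.
Local Notation C := R[i].
Local Notation nm := (@Normc.normc R).
Local Notation Re := (@complex.Re R).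
Local Notation Im := (@complex.Im R).
Implicit Types (f g q : C -> C) (z w c k l : C) (r s d : R).

(** Applied to both coordinates, this retracts the plane onto a square; composition with it turns a
    function continuous on the square into one continuous everywhere. *)
Definition clamp s (x : R) : R := Num.max (- s) (Num.min x s).

Lemma clamp_dist s x y : `|clamp s x - clamp s y| <= `|x - y|.
Proof.
have mx a b : `|Num.max (- s) a - Num.max (- s) b| <= `|a - b|.
  have h1 := ler_norm (a - b); have h2 := ler_norm (b - a); rewrite (distrC b) in h2.
  rewrite ler_norml; case: (leP (- s) a) => h3; case: (leP (- s) b) => h4;
    by apply/andP; split; lra.
apply: le_trans (mx _ _) _.
have h1 := ler_norm (x - y); have h2 := ler_norm (y - x); rewrite (distrC y) in h2.
rewrite ler_norml; case: (leP x s) => h3; case: (leP y s) => h4;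
  by apply/andP; split; lra.
Qed.

Lemma clamp_bound s x : 0 <= s -> `|clamp s x| <= s.
Proof.
move=> s0; rewrite /clamp ler_norml le_max lexx /= ge_max ge_min lexx orbT andbT; lra.
Qed.

Lemma clamp_id s x : `|x| <= s -> clamp s x = x.
Proof.
rewrite ler_norml => /andP[h1 h2].
by rewrite /clamp min_l// max_r.
Qed.

Definition cclamp s z : C := clamp s (Re z) +i* clamp s (Im z).

Lemma cclamp_csquare s z : 0 <= s -> csquare s (cclamp s z).
Proof. by move=> s0; split; exact: clamp_bound. Qed.

Lemma cclamp_id s z : csquare s z -> cclamp s z = z.
Proof. by case: z => x y [/= h1 h2]; rewrite /cclamp /= !clamp_id. Qed.

Lemma cclamp_dist s z w : nm (cclamp s z - cclamp s w) <= 2 * nm (z - w).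
Proof.
apply: le_trans (normc_le_ReIm _) _; rewrite ReB ImB /=.
have k1 := ler_normc_Re (z - w); have k2 := ler_normc_Im (z - w); rewrite ReB in k1; rewrite ImB in k2.
have h2 := clamp_dist s (Re z) (Re w); have h3 := clamp_dist s (Im z) (Im w).
lra.
Qed.

Lemma csquare_near r s z : r < s -> csquare r z -> \forall w \near z, csquare s w.
Proof.
move=> rs [h1 h2]; apply/nbhs_normcP; exists (s - r); first by rewrite subr_gt0.
move=> w wz; have k1 := ler_normc_Re (w - z); have k2 := ler_normc_Im (w - z).
rewrite ReB in k1; rewrite ImB in k2.
have j1 := ler_normD (Re w - Re z) (Re z); have j2 := ler_normD (Im w - Im z) (Im z).
by rewrite subrK in j1; rewrite subrK in j2; split; lra.
Qed.

Lemma csquare_normc r z : csquare r z -> nm z <= 2 * r.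
Proof. by move=> [h1 h2]; apply: le_trans (normc_le_ReIm _) _; lra. Qed.

Lemma is_derive_translate f c k z l :
  is_derive z (1 : C) (fun w => f (w + c) + k) l <-> is_derive (z + c) (1 : C) f l.
Proof.
rewrite !derivable_slopeP !continuous_normcP.
have E w : slope (fun w => f (w + c) + k) z l w = slope f (z + c) l (w + c).
  rewrite /slope (inj_eq (addIr _)); case: eqVneq => // _.
  by congr (_ / _); ring.
split=> H e e0; have [d d0 dH] := H e e0; exists d => // w wd.
  have := dH (w - c); rewrite !E subrK.
  have -> : w - c - z = w - (z + c) by ring.
  exact.
rewrite !E; apply: dH.
by have -> : w + c - (z + c) = w - z by ring.
Qed.

(** Since [r < s], the clamp is the identity on a whole neighbourhood of [z]. *)
Lemma clamp_translate_derive f c k r s z l : r < s -> csquare r z ->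
  is_derive z (1 : C) (fun w => f (cclamp s w + c) + k) l <-> is_derive (z + c) (1 : C) f l.
Proof.
move=> rs zr; rewrite -(is_derive_translate f c k).
by split; apply: near_eq_is_derive; apply: filterS (csquare_near rs zr) => w /cclamp_id ->.
Qed.

Lemma clamp_translate_continuous f c k s : 0 <= s ->
  (forall z, csquare s z -> {for z + c, continuous f}) ->
  continuous (fun w => f (cclamp s w + c) + k).
Proof.
move=> s0 cf z; apply/continuous_normcP => e e0.
have [d d0 dH] := (continuous_normcP _ _).1 (cf _ (cclamp_csquare z s0)) e e0.
exists (d / 2) => [|w wz]; first by rewrite divr_gt0.
have -> : f (cclamp s w + c) + k - (f (cclamp s z + c) + k) = f (cclamp s w + c) - f (cclamp s z + c) by ring.
apply: dH.
have -> : cclamp s w + c - (cclamp s z + c) = cclamp s w - cclamp s z by ring.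
by apply: le_lt_trans (cclamp_dist _ _ _) _; lra.
Qed.

(** The difference quotient of [q] at [z] is the reciprocal of that of [g] at [q z], composed with
    [q]; continuity of [q] is enough to conclude. *)
Lemma inverse_is_derive g q z l : is_derive (q z) (1 : C) g l -> l != 0 ->
  {for z, continuous q} -> (\forall w \near z, g (q w) = w) -> is_derive z (1 : C) q l^-1.
Proof.
move=> /derivable_slopeP cg l0 cq gq; apply/derivable_slopeP.
have gqz := nbhs_singleton gq.
have : {for z, continuous (fun w => (slope g (q z) l (q w))^-1)}.
  apply: (@continuous_fV _ (fun w => slope g (q z) l (q w))).
    by rewrite /slope eqxx.
  exact: (@continuous_comp _ _ _ q (slope g (q z) l) z cq cg).
apply: near_eq_continuous; apply: filterS gq => w gqw.
rewrite /slope; have [->|wz] := eqVneq w z; first by rewrite eqxx.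
have [qwz|_] := eqVneq (q w) (q z); first by move: wz; rewrite -gqw qwz gqz eqxx.
by rewrite gqw gqz invf_div.
Qed.

(* Off z0 the inverse q is differentiable because g' has only isolated zeros;
   at z0 it is differentiable because an isolated singularity of a continuous function is removable. *)
Lemma inverse_derivable g q z0 d : 0 < d ->
  (forall z, nm (z - z0) < d -> {for z, continuous q} /\ g (q z) = z) ->
  (forall w, nm (w - q z0) < d -> derivable g w 1 /\ q (g w) = w) ->
  derivable q z0 1.
Proof.
move=> d0 Hq Hg; set w0 := q z0 in Hg *.
have gw0 : g w0 = z0 by have [] := Hq z0 _; rewrite ?subrr ?Normc.normc0.
(* Points of the square of half-side [s] have modulus at most [2 * s < d]. *)
pose s := d / 4; have s0 : 0 < s by rewrite divr_gt0.
have sd z : csquare s z -> nm z < d by move=> /csquare_normc; rewrite /s; lra.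
pose r := s / 2; have r0 : 0 < r by rewrite divr_gt0.
have rs : r < s by rewrite /r; lra.
have rsq z : csquare r z -> csquare s z by move=> [h1 h2]; split; lra.
have sq0 t : 0 <= t -> csquare t (0 : C) by move=> t0; split; rewrite /= normr0.
pose G w := g (cclamp s w + w0) + (- z0).
have hG : holomorphic_off0 r G.
  split.
    apply: clamp_translate_continuous; first exact: ltW.
    move=> z /sd zd; have [] := Hg (z + w0); first by rewrite addrK.
    by move=> /derivableP/is_derive_continuous.
  move=> z zr _; have [] := Hg (z + w0); first by rewrite addrK; apply/sd/rsq.
  by move=> /derivableP/(clamp_translate_derive g w0 (- z0) _ rs zr).2 [].
have G0 : G 0 = 0.
  by rewrite /G cclamp_id ?add0r ?gw0 ?subrr//; apply: sq0; exact: ltW.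
(* [q (g w) = w] makes [g] injective near [w0], so [G] does not vanish identically near 0. *)
have Gn0 (e : R) : 0 < e -> exists2 z, nm z < e & G z != 0.
  move=> e0; have [|w wn0] := @exists_real_lt R (Num.min e s); first by rewrite lt_min e0.
  rewrite lt_min => /andP[we ws]; exists w => //.
  rewrite /G cclamp_id; last exact: normc_csquare (ltW ws).
  rewrite subr_eq0; apply: contra wn0 => /eqP gw.
  have [|_] := Hg (w + w0); first by rewrite addrK; apply/sd/normc_csquare/ltW.
  by rewrite gw -/w0 => /eqP; rewrite -subr_eq0 opprD addrCA subrr addr0 oppr_eq0.
have [d1 d10 H1] := derive_neq0_near r0 hG G0 Gn0.
have cq0 : {for z0, continuous q} by have [] := Hq z0 _; rewrite ?subrr ?Normc.normc0.
have [|d2 d20 H2] := (continuous_normcP q z0).1 cq0 (Num.min d1 r).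
  by rewrite lt_min d10.
(* Small enough that [q] sends the square about [z0] into the region where [G'] is nonzero off 0 and
   the clamp in [G] is the identity. *)
pose r' := Num.min s d2 / 4.
have m0 : 0 < Num.min s d2 by rewrite lt_min s0.
have r'0 : 0 < r' by rewrite divr_gt0.
have ms : Num.min s d2 <= s by rewrite ge_min lexx.
have md : Num.min s d2 <= d2 by rewrite ge_min lexx orbT.
have r's : r' < s by rewrite /r'; lra.
pose Q z := q (cclamp s z + z0) + (- w0).
have hQ : holomorphic_off0 r' Q.
  split.
    apply: clamp_translate_continuous; first exact: ltW.
    by move=> z /sd zd; have [] := Hq (z + z0); first by rewrite addrK.
  move=> z zr zn0.
  have zn : nm z <= 2 * r' := csquare_normc zr.
  have zd2 : nm z < d2 by rewrite /r' in zn; lra.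
  have zs : nm z < s by rewrite /r' in zn; lra.
  have zd : nm (z + z0 - z0) < d by rewrite addrK; apply/sd/normc_csquare/ltW.
  have [cqz gqz] := Hq _ zd.
  have := H2 (z + z0); rewrite addrK => /(_ zd2); rewrite lt_min -/w0 => /andP[qd1 qr].
  have qn0 : q (z + z0) - w0 != 0.
    rewrite subr_eq0; apply: contra zn0 => /eqP qw.
    by move: gqz; rewrite qw gw0 => /eqP; rewrite eq_sym -subr_eq0 addrK.
  have [l dl l0] := H1 _ qn0 qd1.
  have qsq : csquare r (q (z + z0) - w0) by apply: normc_csquare; exact: ltW.
  have := (clamp_translate_derive g w0 (- z0) l rs qsq).1 dl; rewrite subrK => dgl.
  have gq : \forall w \near z + z0, g (q w) = w.
    apply/nbhs_normcP; exists (d - nm z); first by rewrite subr_gt0; move: zd; rewrite addrK.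
    move=> w wz; have [] // := Hq w.
    have := le_normcD (w - (z + z0)) z.
    have -> : w - (z + z0) + z = w - z0 by ring.
    lra.
  have := inverse_is_derive dgl l0 cqz gq.
  by move=> /(clamp_translate_derive q z0 (- w0) _ r's zr).2 [].
have [L HL] := holomorphic_off0_derivable r'0 hQ.
have n0 : nm (0 : C) <= r' / 4 by rewrite Normc.normc0; lra.
have [l dl _] := HL 0 n0.
have := (clamp_translate_derive q z0 (- w0) l r's (sq0 r' (ltW r'0))).1 dl.
by rewrite add0r => -[].
Qed.

End inverse.

(** * Oscillation and uniform continuity on the line *)

Section real_line.
Variable R : realType.
Local Notation C := R[i].
Local Notation nm := (@Normc.normc R).
Local Notation Re := (@complex.Re R).
Local Notation Im := (@complex.Im R).
Implicit Types (u : R -> R) (t y a d e : R).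

(** Only [t] is confined to the segment: once [t] is moved into a period, [y] may fall outside
    it. *)
Lemma segment_unif_continuous u a b e : continuous u -> 0 < e ->
  exists2 d, 0 < d & forall t y, a <= t <= b -> `|y - t| < d -> `|u y - u t| < e.
Proof.
move=> cu e0.
have /compact_near_coveringP/(_ R (0 : R)^'+
  (fun d t => forall y, `|y - t| < d -> `|u y - u t| < e)) := @segment_compact R a b.
case.
- move=> t _.
  have /cu : nbhs (u t) [set x | `|x - u t| < e / 2].
    by apply/nbhs_ballP; exists (e / 2); rewrite /= ?divr_gt0// => x; rewrite -ball_normE /= distrC.
  move=> /nbhs_ballP[h /= h0 hH].
  exists ([set t' | `|t' - t| < h / 2], [set d | d < h / 2]) => /=.
    split; first by apply/nbhs_ballP; exists (h / 2); rewrite /= ?divr_gt0// => x; rewrite -ball_normE /= distrC.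
    by apply: nbhs_right_lt; rewrite divr_gt0.
  move=> [t' d] /= [t't dh] y yt'.
  have h1 : `|u t' - u t| < e / 2.
    by apply: hH; rewrite -ball_normE /= distrC; lra.
  have h2 : `|u y - u t| < e / 2.
    apply: hH; rewrite -ball_normE /= distrC.
    by have := ler_normD (y - t') (t' - t); rewrite addrA subrK; lra.
  have := ler_normB (u y - u t) (u t' - u t).
  by rewrite opprB addrA subrK; lra.
- move=> d /= d0 dH.
  exists (d / 2); first by rewrite divr_gt0.
  move=> t y tab yt; apply: (dH (d / 2)); rewrite /= ?in_itv//= ?sub0r ?normrN ?divr_gt0//.
  by rewrite gtr0_norm ?divr_gt0//; lra.
Qed.

Lemma periodic_unif_continuous u T e : 0 < T -> (forall t, u (t + T) = u t) ->
  continuous u -> 0 < e ->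
  exists2 d, 0 < d & forall t y, `|y - t| < d -> `|u y - u t| < e.
Proof.
move=> T0 uT cu e0.
have uTn t (n : nat) : u (t + n%:R * T) = u t.
  elim: n => [|n IH]; first by rewrite mul0r addr0.
  by rewrite -natr1 mulrDl mul1r addrA uT.
have uTz t (m : int) : u (t + m%:~R * T) = u t.
  case: m => n; first exact: uTn.
  rewrite NegzE mulrNz mulNr.
  by rewrite -[LHS](uTn _ n.+1) subrK.
have [d d0 dH] := segment_unif_continuous 0 T cu e0.
exists d => // t y yt; pose m := Num.floor (t / T).
rewrite -(uTz t (- m)) -(uTz y (- m)); apply: dH.
  have := floor_itv (t / T); rewrite -/m => /andP[h1 h2].
  move: h1 h2; rewrite ler_pdivlMr// ltr_pdivrMr// intrD1 mulrDl mul1r => h1 h2.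
  by rewrite mulrNz mulNr; apply/andP; split; lra.
by rewrite opprD addrACA subrr addr0.
Qed.

Lemma derivable_lipschitz_at u t : derivable u t 1 ->
  exists L, exists2 d, 0 < d & forall y, `|y - t| < d -> `|u y - u t| <= L * `|y - t|.
Proof.
move=> /derivableP dfu; pose l := 'D_1 u t.
have : (fun h => h^-1 *: (u (h *: 1 + t) - u t)) @ (0 : R)^' --> l by case: dfu.
move=> /cvgrPdist_lt /(_ 1 ltr01).
rewrite /prop_near1 /nbhs /= /dnbhs /within /= => /nbhs_ballP[d /= d0 dH].
exists (`|l| + 1); exists d => // y yt.
have [->|nyt] := eqVneq y t; first by rewrite !subrr normr0 mulr0.
have := dH (y - t); rewrite -ball_normE /= sub0r normrN => /(_ yt).
rewrite subr_eq0 => /(_ nyt); rewrite /GRing.scale /= mulr1 subrK.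
set v := (y - t)^-1 * _ => lv.
have -> : u y - u t = v * (y - t) by rewrite /v mulrAC mulVf ?mul1r// subr_eq0.
rewrite normrM ler_wpM2r//.
have := ler_normD (v - l) l; rewrite subrK (distrC v) => h; lra.
Qed.

Lemma expi0 : expi (0 : R) = 1.
Proof. by rewrite /expi cos0 sin0. Qed.

Lemma expiD t y : expi (t + y) = expi t * expi y.
Proof.
rewrite /expi cosD sinD; apply/eqP; rewrite eq_complex /= eqxx /=.
by apply/eqP; ring.
Qed.

Lemma expiX t n : expi t ^+ n = expi (n%:R * t).
Proof.
elim: n => [|n IH]; first by rewrite expr0 mul0r expi0.
by rewrite exprSr IH -expiD -natr1 mulrDl mul1r.
Qed.

Lemma expi_periodic t : expi (t + pi *+ 2) = expi t.
Proof. by rewrite /expi cosD2pi sinD2pi. Qed.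

Lemma normc_expi t : nm (expi t) = 1.
Proof. by rewrite /Normc.normc /expi cos2Dsin2 sqrtr1. Qed.

Lemma continuous_expi : continuous (@expi R).
Proof.
move=> t A /nbhs_normcP[d d0 dA].
have near_fun u : continuous u -> \forall y \near t, `|u y - u t| < d / 2.
  move=> cu; have /cu : nbhs (u t) [set x | `|x - u t| < d / 2].
    by apply/nbhs_ballP; exists (d / 2); rewrite /= ?divr_gt0// => x; rewrite -ball_normE /= distrC.
  by [].
apply: filterS2 (near_fun _ (@continuous_cos R)) (near_fun _ (@continuous_sin R)) => y h1 h2.
by apply: dA; apply: le_lt_trans (normc_le_ReIm _) _; rewrite /=; lra.
Qed.

Definition part (b : bool) (z : C) : R := if b then Re z else Im z.

Lemma partD b z w : part b (z + w) = part b z + part b w.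
Proof. by case: b; case: z w => ? ? []. Qed.

Lemma partN b z : part b (- z) = - part b z.
Proof. by case: b; case: z => ? ?. Qed.

Lemma part_real b x z : part b (x%:C * z) = x * part b z.
Proof. by case: b; case: z => ? ? /=; ring. Qed.

Lemma ler_part_normc b z : `|part b z| <= nm z.
Proof. by case: b; [exact: ler_normc_Re|exact: ler_normc_Im]. Qed.

(** If the chosen coordinate has modulus at least 1/4, a half turn changes its sign. Otherwise the
    other coordinate has modulus at least 3/4, and a quarter turn brings it in up to sign. *)
Lemma expi_oscillation b a :
  exists2 h, 0 < h <= pi & 2^-1 <= `|part b (expi (a + h)) - part b (expi a)|.
Proof.
have pi0 := pi_gt0 R; have cs := cos2Dsin2 a.
have key (x y : R) : x ^+ 2 + y ^+ 2 = 1 ->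
    2^-1 <= `|- x - x| \/ (2^-1 <= `|- y - x| /\ 2^-1 <= `|y - x|).
  move=> xy; case: (lerP 2^-1 `|- x - x|) => h; first by left.
  right; move: h; rewrite ltr_norml => /andP[h1 h2].
  have yy : (3 / 4) ^+ 2 <= `|y| ^+ 2 by rewrite real_normK ?num_real//; nra.
  have {}yy : 3 / 4 <= `|y| by rewrite -(@ler_pXn2r _ 2) ?nnegrE//; lra.
  have xx : `|x| <= 4^-1 by rewrite ler_norml; apply/andP; split; lra.
  have k1 := lerB_dist (- y) x; have k2 := lerB_dist y x; rewrite normrN in k1.
  by split; lra.
case: b; rewrite /part /expi /=.
  case: (key _ _ cs) => [h|[h _]].
    by exists pi; [rewrite pi0 lexx|rewrite cosDpi].
  by exists (pi / 2); [apply/andP; split; lra|rewrite cosDpihalf].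
rewrite addrC in cs; case: (key _ _ cs) => [h|[_ h]].
  by exists pi; [rewrite pi0 lexx|rewrite sinDpi].
by exists (pi / 2); [apply/andP; split; lra|rewrite sinDpihalf].
Qed.

End real_line.

(** * Boundary traces on the sphere *)

Section sphere.
Variable R : realType.
Local Notation C := R[i].
Local Notation nm := (@Normc.normc R).
Local Notation Re := (@complex.Re R).
Local Notation Im := (@complex.Im R).
Implicit Types (f g q : C -> C) (z w : C) (O : set C).

Lemma within_continuousE (T S : topologicalType) (A : set T) (f : T -> S) :
  {within A, continuous f} <->
  (forall x, A x -> forall B, nbhs (f x) B -> nbhs x [set y | A y -> B (f y)]).
Proof.
rewrite subspace_continuousP; split => H x Ax.
  by move=> B /(H x Ax).
by move=> B /(H x Ax).
Qed.

(** Boundedness keeps the closure away from infinity: the complement of a compact square, together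
    with [None], is a neighbourhood of [None] that misses the image of [O]. *)
Lemma closure_to_sphere O (p : Chat R) : (exists M : R, forall z, O z -> `|z| <= M%:C) ->
  closure (to_sphere O) p -> exists2 w, p = Some w & closure O w.
Proof.
move=> [M OM]; case: p => [w|] cO.
  exists w => // B /one_point_compactification_some_nbhs/cO[_ [[z Oz <-] [z' Bz' [zz']]]].
  by exists z; split => //; rewrite -zz'.
have cc : compact (csquare M) := @compact_csquare R M.
have [] := cO ((Some @` (~` csquare M)) `|` [set None]).
  exists (csquare M) => //; split => //; apply: compact_closed => //.
move=> _ [[z Oz <-] [[z' nz' [zz']]|//]]; exfalso; apply: nz'; rewrite zz'.
by apply: normc_csquare; have := OM _ Oz; rewrite normr_normc lecR.
Qed.

Lemma to_sphere_closure O w : closure O w -> closure (to_sphere O) (Some w : Chat R).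
Proof.
by move=> cO B nB; have [z [Oz Bz]] := cO (Some @^-1` B) nB; exists (Some z); split => //; exists z.
Qed.

(** The components other than [V i] are finitely many closed sets that do not contain [p], so some
    neighbourhood of [p] misses them all. Its points outside [V i] then lie in the image of [O]. *)
Lemma component_boundary O n (V : nat -> set (Chat R)) i (p : Chat R) :
  open O ->
  (forall i, (i < n)%N -> exists p : Chat R,
      ~ (to_sphere O) p /\ V i = connected_component (~` (to_sphere O)) p) ->
  (forall i j, (i < n)%N -> (j < n)%N -> V i = V j -> i = j) ->
  (forall p : Chat R, ~ (to_sphere O) p -> exists2 i, (i < n)%N & V i p) ->
  (i < n)%N -> V i p -> closure (~` V i) p -> closure (to_sphere O) p.
Proof.
move=> oO VE Vinj Vcov iN Vip cV B nB.
have oS : open (to_sphere O) by exact: one_point_compactification_open_some.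
have Vcl j : (j < n)%N -> closed (V j).
  by move=> /VE[x [_ ->]]; apply: component_closed; exact: open_closedC.
have Vsep j : (j < n)%N -> V j p -> j = i.
  move=> jN Vjp; apply: Vinj => //.
  have [x [_ jE]] := VE j jN; have [y [_ iE]] := VE i iN.
  rewrite jE in Vjp *; rewrite iE in Vip *.
  by rewrite (same_connected_component Vjp) (same_connected_component Vip).
have FF : Filter (nbhs p) := nbhs_filter p.
have nU : nbhs p [set x | forall j : 'I_n, nat_of_ord j != i -> ~ V j x].
  apply: (@filter_forall _ _ (fun j : 'I_n => [set x | nat_of_ord j != i -> ~ V j x]) _ FF) => j.
  have [->|ji] := eqVneq (nat_of_ord j) i; first by apply: (@filterE _ _ FF).
  have nj : nbhs p (~` V j).
    apply: open_nbhs_nbhs; split; first exact/closed_openC/Vcl.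
    by move=> /(Vsep _ (ltn_ord j)) E; rewrite E eqxx in ji.
  by apply: (@filterS _ _ FF _ _ _ nj) => x nx _.
have [x [nVx [Bx Ux]]] := cV _ (@filterI _ _ FF _ _ nB nU).
exists x; split => //; apply: contrapT => /Vcov[j jN Vjx].
have [ji|ji] := eqVneq j i; first by apply: nVx; rewrite -ji.
exact: (Ux (Ordinal jN) ji Vjx).
Qed.

(** * The inverse of a Riemann mapping, restricted to Omega *)

Section riemann_mapping.
Variables (O : set C) (U : set (Chat R)) (phi : C -> Chat R) (psi : Chat R -> C).
Hypothesis oO : open O.
Hypothesis OU : to_sphere O `<=` U.
Hypothesis cphi : {within @cudisc R, continuous phi}.
Hypothesis imphi : phi @` @cudisc R = closure U.
Hypothesis cpsi : {within closure U, continuous psi}.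
Hypothesis psiK : forall z, cudisc z -> psi (phi z) = z.
Hypothesis phiU : phi @` @udisc R = U.
Hypothesis hphi : forall z, udisc z -> sphere_holomorphic_at phi z.

Let q z := psi (Some z).

Lemma cudiscE z : cudisc z = (nm z <= 1) :> Prop.
Proof. by rewrite /cudisc /= normr_normc -[1]/(1%:C) lecR. Qed.

Lemma udiscE z : udisc z = (nm z < 1) :> Prop.
Proof. by rewrite /udisc /= normr_normc -[1]/(1%:C) ltcR. Qed.

Lemma udisc_cudisc z : udisc z -> cudisc z.
Proof. by rewrite cudiscE udiscE => /ltW. Qed.

Lemma closure_sphere_domain z : closure O z -> closure U (Some z : Chat R).
Proof. by move=> /to_sphere_closure; exact: closureS. Qed.

Lemma inverse_normc_le1 z : closure O z -> nm (q z) <= 1.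
Proof.
move=> /closure_sphere_domain; rewrite -imphi => -[w wD wz].
by rewrite /q -wz psiK// -cudiscE.
Qed.

Lemma inverse_within_continuous : {within closure O, continuous q}.
Proof.
apply/within_continuousE => z cz B nB.
have := (within_continuousE _ _).1 cpsi (Some z) (closure_sphere_domain cz) B nB.
rewrite /nbhs /=; apply: filterS => w /= h cw.
by apply: h; exact: closure_sphere_domain.
Qed.

Lemma inverse_continuous z : O z -> {for z, continuous q}.
Proof.
move=> Oz B nB.
have := (within_continuousE _ _).1 inverse_within_continuous z (subset_closure Oz) B nB.
move=> h; have nO : nbhs z O by exact: open_nbhs_nbhs.
apply: filterS2 h nO => w h Ow; apply: h; exact: subset_closure.
Qed.

(** The mapping [phi] may take the value infinity in the disc. Near [q z] its values lie in the
    image of [O], so there it is differentiable in the finite chart and [inverse_derivable] applies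
    to [fin] composed with [phi]. *)
Lemma inverse_holomorphic z : O z -> derivable q z 1.
Proof.
move=> Oz.
have Uphi w : O w -> exists2 v, udisc v & phi v = Some w.
  by move=> Ow; have : U (Some w) by [apply: OU; exists w]; rewrite -phiU => -[v]; exists v.
have phiq w : O w -> udisc (q w) /\ phi (q w) = Some w.
  move=> /Uphi[v vD vw]; rewrite /q -vw psiK//; exact: udisc_cudisc.
have [d1 d10 H1] : exists2 d : R, 0 < d & forall w, nm (w - z) < d -> O w.
  by apply/nbhs_normcP; exact: open_nbhs_nbhs.
have [qD qz] := phiq _ Oz.
have [d2 d20 H2] : exists2 d : R, 0 < d & forall v, nm (v - q z) < d -> udisc v /\ to_sphere O (phi v).
  apply/nbhs_normcP; apply: filterI.
    apply/nbhs_normcP; exists (1 - nm (q z)); first by rewrite subr_gt0 -udiscE.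
    by move=> v vq; rewrite udiscE; have := le_normcD (v - q z) (q z); rewrite subrK; lra.
  have [cq _] := hphi qD; apply: cq; rewrite qz.
  by apply: one_point_compactification_some_nbhs; exact: open_nbhs_nbhs.
apply: (@inverse_derivable _ (fun v => fin (phi v)) q z (Num.min d1 d2)).
- by rewrite lt_min d10.
- move=> w; rewrite lt_min => /andP[/H1 Ow _]; split; first exact: inverse_continuous.
  by have [_ ->] := phiq _ Ow.
- move=> v; rewrite lt_min => /andP[_ /H2[vD [w Ow wv]]].
  have [_] := hphi vD; rewrite -wv => dv; split; first exact: dv.
  by rewrite /q /= wv psiK//; exact: udisc_cudisc.
Qed.

End riemann_mapping.

Lemma in_A_perturb O f q (c : C) N : in_A O f -> in_A O q ->
  in_A O (fun z => f z + c * q z ^+ N).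
Proof.
move=> [cf df] [cq dq]; split.
  have cX m : {within closure O, continuous (fun z => q z ^+ m)}.
    elim: m => [|m IH].
      have -> : (fun z => q z ^+ 0) = (fun=> 1) by apply/funext => z; rewrite expr0.
      exact: (@cst_continuous (subspace (closure O))).
    have -> : (fun z => q z ^+ m.+1) = (fun z => q z * q z ^+ m).
      by apply/funext => z; rewrite exprS.
    by move=> x; exact: (@continuousM _ (subspace (closure O)) q (fun z => q z ^+ m) x (cq x) (IH x)).
  move=> x; apply: (@continuousD _ _ (subspace (closure O)) f (fun z => c * q z ^+ N) x (cf x)).
  have := cX N x; move: x; move=> x hx.
  apply: (@continuousM _ (subspace (closure O)) (fun=> c) (fun z => q z ^+ N) x _ hx).
  exact: (@cst_continuous (subspace (closure O))).
move=> z Oz; have /derivableP d1 := df z Oz; have /derivableP d2 := dq z Oz.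
have d3 : derivable (fun z => q z ^+ N) z 1.
  elim: N => [|m IH].
    have -> : (fun z => q z ^+ 0) = (fun=> 1) by apply/funext => w; rewrite expr0.
    exact: derivable_cst.
  have -> : (fun z => q z ^+ m.+1) = (fun z => q z * q z ^+ m).
    by apply/funext => w; rewrite exprS.
  by have [] := is_derive_fM d2 (derivableP IH).
have d4 := is_derive_fM (is_derive_cst c z (1 : C)) (derivableP d3).
by have [] := is_derive_fD d1 d4.
Qed.

(** Every boundary value is finite and lies in the closure of [O], so the default value of [fin]
    never enters and continuity within the closure is enough. *)
Lemma boundary_trace_continuous O f (phi : C -> Chat R) b :
  {within closure O, continuous f} -> {within @cudisc R, continuous phi} ->
  (forall t : R, exists2 w, phi (expi t) = Some w & closure O w) ->
  continuous (fun t => part b (f (fin (phi (expi t))))).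
Proof.
move=> cf cphi bd t B /nbhs_ballP[e /= e0 eB].
have cD (s : R) : cudisc (expi s) by rewrite cudiscE normc_expi.
have [w wE cw] := bd t.
have nf := (within_continuousE _ _).1 cf w cw [set v | nm (v - f w) < e].
have {nf} : nbhs w [set v | closure O v -> nm (f v - f w) < e].
  by apply: nf; apply/nbhs_normcP; exists e.
move=> /one_point_compactification_some_nbhs nS.
have := (within_continuousE _ _).1 cphi (expi t) (cD t) _.
rewrite wE => /(_ _ nS) /continuous_expi nt.
apply: (@filterS _ (nbhs t) _ _ _ _ nt) => s /(_ (cD s)) [v vH vE].
apply: eB; rewrite -ball_normE.
change (`|part b (f (fin (phi (expi t)))) - part b (f (fin (phi (expi s))))| < e).
have [v' v'E cv'] := bd s; move: v'E; rewrite -vE => -[vv']; rewrite -vv' in cv'.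
rewrite wE distrC -partN -partD.
by apply: le_lt_trans (ler_part_normc _ _) _; exact: vH.
Qed.

(* The margin d makes the condition stable under uniform perturbations. *)
Definition steep (k : nat) (u : R -> R) :=
  exists2 d : R, 0 < d & forall t : R, exists2 y : R,
    `|y - t| <= k.+1%:R^-1 & k%:R * `|y - t| + d <= `|u y - u t|.

(** Differentiability at [t] gives a Lipschitz bound [L] at [t] within some radius [d]. It
    contradicts [steep k] once [k] exceeds both [L] and [1 / d]; the positive margin excludes
    [y = t]. *)
Lemma steep_nowhere_differentiable u : (forall k, steep k u) -> nowhere_differentiable u.
Proof.
move=> su t /derivable_lipschitz_at[L [d d0 H]].
pose k := (Num.truncn (Num.max L d^-1)).+1.
have mk : Num.max L d^-1 < k%:R by exact: truncnS_gt.
move: mk; rewrite gt_max => /andP[Lk dk].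
have [e e0 /(_ t)[y yt]] := su k.
have k0 : 0 < (k.+1%:R : R) by rewrite ltr0n.
have yd : `|y - t| < d.
  apply: le_lt_trans yt _; rewrite -[ltRHS]invrK ltf_pV2 ?posrE ?invr_gt0//.
  by apply: lt_trans dk _; rewrite ltr_nat.
have := H y yd; have := normr_ge0 (y - t); nra.
Qed.

(** Two values move by at most [d / 4] each, so half the margin survives. The margin is explicit
    here because it determines the radius of the neighbourhood in A(Omega). *)
Lemma steep_perturb k u v d : 0 < d ->
  (forall t : R, exists2 y : R, `|y - t| <= k.+1%:R^-1 & k%:R * `|y - t| + d <= `|u y - u t|) ->
  (forall t, `|v t - u t| <= d / 4) -> steep k v.
Proof.
move=> d0 su uv; exists (d / 2); first by rewrite divr_gt0.
move=> t; have [y y1 y2] := su t; exists y => //.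
have h1 := uv t; have h2 := uv y.
have h3 := ler_normD (v y - v t) ((u y - v y) + (v t - u t)).
have h4 := ler_normD (u y - v y) (v t - u t).
have e1 : v y - v t + (u y - v y + (v t - u t)) = u y - u t by ring.
rewrite e1 in h3; rewrite (distrC (u y)) in h4; lra.
Qed.

(** Over a step of at most [pi / N] the oscillating term changes by at least [e / 2] and [u] by less
    than [e / 8]. What remains exceeds the [e / 8] that bounds [k * |y - t|] plus the margin
    [e / 8]. *)
Lemma steep_oscillation k b u v e : 0 < e ->
  (forall a, 0 < a -> exists2 d : R, 0 < d & forall t y, `|y - t| < d -> `|u y - u t| < a) ->
  (forall N t, v N t = u t + e * part b (expi t ^+ N)) ->
  exists N, steep k (v N).
Proof.
move=> e0 uu vE; have [|d d0 dH] := uu (e / 8); first by rewrite divr_gt0.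
have pi0 := pi_gt0 R.
have k0 : 0 < (k.+1%:R : R) by rewrite ltr0n.
(* The three summands make [pi / N] smaller than [d], [1 / (k + 1)] and [e / (8 (k + 1))]
   respectively. *)
pose B := pi * (d^-1 + k.+1%:R + 8 * k.+1%:R / e).
pose N := (Num.truncn B).+1.
have BN : B < N%:R by exact: truncnS_gt.
have N0 : 0 < (N%:R : R) by rewrite ltr0n.
have p1 : 0 < d^-1 by rewrite invr_gt0.
have p2 : 0 < 8 * k.+1%:R / e by rewrite divr_gt0// mulr_gt0.
have N1 : pi / N%:R < d.
  by rewrite ltr_pdivrMr// mulrC -ltr_pdivrMr//; apply: le_lt_trans BN; rewrite /B ler_wpM2l ?ltW//; lra.
have N2 : (pi : R) / N%:R <= k.+1%:R^-1.
  rewrite -[leRHS]mul1r ler_pdivlMr// mulrAC ler_pdivrMr// mul1r; apply: le_trans (ltW BN).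
  by rewrite /B ler_wpM2l ?ltW//; lra.
have N3 : k.+1%:R * (pi / N%:R) <= e / 8.
  rewrite mulrA ler_pdivrMr//.
  have -> : k.+1%:R * pi = e / 8 * (pi * (8 * k.+1%:R / e)) by field; rewrite gt_eqF.
  rewrite ler_wpM2l ?divr_ge0 ?ltW//; apply: le_lt_trans BN.
  by rewrite /B ler_wpM2l ?ltW//; lra.
exists N; exists (e / 8); first by rewrite divr_gt0.
move=> t; have [h /andP[h0 hpi] hosc] := expi_oscillation b (N%:R * t).
have yt : `|t + h / N%:R - t| <= pi / N%:R.
  rewrite addrAC subrr add0r gtr0_norm; last exact: divr_gt0.
  by rewrite ler_pM2r// invr_gt0.
exists (t + h / N%:R); first exact: le_trans yt N2.
have := dH t (t + h / N%:R) (le_lt_trans yt N1); rewrite !vE !expiX.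
have -> : N%:R * (t + h / N%:R) = N%:R * t + h.
  by rewrite mulrDr mulrCA divff ?mulr1// gt_eqF.
set P := part b _ in hosc *; set Q := part b _ in hosc *.
set y := t + h / N%:R in yt * => uy.
have h1 := ler_normB ((u y + e * P) - (u t + e * Q)) (u y - u t).
have e1 : u y + e * P - (u t + e * Q) - (u y - u t) = e * (P - Q) by ring.
rewrite e1 normrM (gtr0_norm e0) in h1.
have h2 : e * 2^-1 <= e * `|P - Q| by rewrite ler_pM2l.
have h3 : k%:R * `|y - t| <= k.+1%:R * (pi / N%:R).
  by apply: ler_pM => //; rewrite ler_nat.
lra.
Qed.

End sphere.

Theorem theorem4p3 (R : realType) (Omega : set R[i]) (n : nat)
    (V : nat -> set (Chat R)) (phi : nat -> R[i] -> Chat R) :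
  bounded_domain Omega ->
  (* the boundary of Omega consists of n disjoint Jordan curves *)
  (exists J : nat -> set R[i],
      [/\ (forall i, (i < n)%N -> jordan_curve (J i)),
          (forall i j, (i < n)%N -> (j < n)%N -> i <> j -> J i `&` J j = set0) &
          cboundary Omega = \bigcup_(i in [set i | (i < n)%N]) J i]) ->
  (* V_0, ..., V_{n-1} are the connected components of \hat C \ Omega *)
  (forall i, (i < n)%N -> exists p : Chat R,
      ~ (to_sphere Omega) p /\ V i = connected_component (~` (to_sphere Omega)) p) ->
  (forall i j, (i < n)%N -> (j < n)%N -> V i = V j -> i = j) ->
  (forall p : Chat R, ~ (to_sphere Omega) p -> exists2 i, (i < n)%N & V i p) ->
  (* oo belongs to V_0 *)
  V 0%N None ->
  (* phi_i : cl(D) -> cl(Omega_i) Riemann mappings, Omega_i = \hat C \ V_i *)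
  (forall i, (i < n)%N -> riemann_mapping (~` V i) (phi i)) ->
  residual_in_A Omega (fun f : R[i] -> R[i] =>
    forall i, (i < n)%N ->
      nowhere_differentiable (fun t : R => complex.Re (f (fin (phi i (expi t))))) /\
      nowhere_differentiable (fun t : R => complex.Im (f (fin (phi i (expi t)))))).
Proof.
move=> [oO _ _ bO] _ VE Vinj Vcov _ HR.
pose tr i b (f : R[i] -> R[i]) (t : R) := part b (f (fin (phi i (expi t)))).
(* One condition for each level, curve and part, enumerated through [unpickle]; numbers that are not
   codes, and indices [i >= n], impose nothing. *)
pose G m : set (R[i] -> R[i]) := fun f =>
  if @unpickle (nat * nat * bool)%type m is Some (k, i, b) then
    (i < n)%N -> steep k (tr i b f) else True.
have circ i (iN : (i < n)%N) t :
    exists2 w, phi i (expi t) = Some w & closure Omega w.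
  have [[cphi injphi imphi _] [phiU _]] := HR i iN.
  have cD : cudisc (expi t) by rewrite cudiscE normc_expi.
  apply: (closure_to_sphere bO); apply: (component_boundary oO VE Vinj Vcov iN).
    (* The complement of [V i] is the image of the open disc, so by injectivity no point of the
       circle is sent there. *)
    apply: contrapT => nV.
    have : (~` V i) (phi i (expi t)) by [].
    rewrite -phiU => -[w wD /injphi wE].
    have ww := wE (udisc_cudisc wD) cD.
    by move: wD; rewrite ww udiscE normc_expi ltxx.
  by rewrite -imphi; exists (expi t).
exists G; split=> [m|f _ Gf i iN]; last first.
  have st b : nowhere_differentiable (tr i b f).
    apply: steep_nowhere_differentiable => k.
    by have := Gf (pickle (k, i, b)); rewrite /G pickleK; apply.
  by split; [exact: (st true)|exact: (st false)].
rewrite /G; case: unpickle => [[[k i] b]|]; last first.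
  split; first by move=> f _ _; exists 1.
  move=> f Af e e0; exists f; split => // z _; rewrite subrr normr0.
  by rewrite ler0c ltW.
have [iN|nN] := boolP (i < n)%N; last first.
  split; first by move=> f _ _; exists 1.
  move=> f Af e e0; exists f; split => // z _; rewrite subrr normr0.
  by rewrite ler0c ltW.
split.
  move=> f _ /(_ isT)[d d0 su]; exists (d / 4); first by rewrite divr_gt0.
  move=> g _ fg _; apply: steep_perturb d0 su _ => t.
  have [w wE cw] := circ i iN t.
  rewrite /tr wE -partN -partD; apply: le_trans (ler_part_normc _ _) _.
  by have := fg w cw; rewrite normr_normc lecR normcB.
move=> f Af e e0.
have [[cphi _ imphi [psi [cpsi psiK]]] [phiU hphi]] := HR i iN.
have OU : to_sphere Omega `<=` ~` V i.
  have [p [_ ->]] := VE i iN => x Ox Vx.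
  exact: (connected_component_sub Vx).
pose q z := psi (Some z).
have Aq : in_A Omega q.
  split; first exact: inverse_within_continuous OU cpsi.
  move=> z; exact: inverse_holomorphic oO OU cpsi psiK phiU hphi _.
have [cf _] := Af.
have uc a : 0 < a -> exists2 d : R, 0 < d & forall t y : R,
    `|y - t| < d -> `|tr i b f y - tr i b f t| < a.
  apply: (@periodic_unif_continuous _ _ (pi *+ 2)).
  - by rewrite mulrn_wgt0// pi_gt0.
  - by move=> t; rewrite /tr expi_periodic.
  - exact: boundary_trace_continuous cf cphi (circ i iN).
(* On the circle [psi (phi z) = z], so the trace of the added term is [e] times the chosen part of
   [expi t ^+ N]. *)
have [|N sN] := @steep_oscillation R k b (tr i b f)
  (fun N => tr i b (fun z => f z + e%:C * q z ^+ N)) e e0 uc.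
  move=> N t; have [w wE cw] := circ i iN t.
  rewrite /tr wE partD part_real /q /= -wE psiK//.
  by rewrite cudiscE normc_expi.
exists (fun z => f z + e%:C * q z ^+ N); split.
- exact: in_A_perturb Af Aq.
- by move=> _; exact: sN.
(* The added term has modulus at most [e], since [psi] has modulus at most 1 on the closure of
   Omega. *)
move=> z cz; rewrite normr_normc lecR opprD addrA subrr add0r normcN.
rewrite Normc.normcM normc_real (gtr0_norm e0) normcX ger_pMr// exprn_ile1 ?normc_ge0//.
exact: inverse_normc_le1 OU imphi psiK _ cz.
Qed.
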